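(* Let $h,w \ge 2$ be integers. Then $$I(h,w) = \begin{cases} \{0,1,2,3,4,6,8,9,12,16\} & \text{if } h=w=2;\\ \Upsilon(hw) & \text{otherwise.}\end{cases}$$
   Context: For a positive integer $n$, write $[n]=\{1,2,\dots,n\}$. A latin square of order $n$ is an $n\times n$ array with entries from a set of $n$ symbols such that each symbol appears exactly once in every row and exactly once in every column. Let $h,w\ge 2$ be integers and $n=hw$. A Sudoku latin square of type $(h,w)$ is a latin square of order $n$ whose cells are partitioned into $h\times w$ boxes (a box consists of $h$ consecutive rows and $w$ consecutive columns, i.e. for $a\in[w]$, $b\in[h]$ the box with rows $(a-1)h+1,\dots,ah$ and columns $(b-1)w+1,\dots,bw$, so the boxes form a $w\times h$ grid) such that each symbol appears exactly once in every box. Let $\mathcal{SL}_{h,w}$ denote the set of all Sudoku latin squares of type $(h,w)$ with this common partition into boxes and a common symbol set (e.g. $[n]$). For two latin squares $L,L'$ of order $n$ with the same row, column and symbol sets, $L\cap L'=\{(i,j,k): L_{ij}=L'_{ij}=k\}$, so $|L\cap L'|$ is the number of cells in which $L$ and $L'$ agree. Define $$I(h,w)=\{|L\cap L'| : L,L'\in\mathcal{SL}_{h,w}\}$$ and, for a positive integer $n$, $$\Upsilon(n)=\{0,1,2,\dots,n^2-6,\,n^2-4,\,n^2\},$$ that is, all integers from $0$ to $n^2$ except $n^2-5,n^2-3,n^2-2,n^2-1$. *)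

(* Defs.v *)
(* Rows, columns and symbols are numbered from 0, so [n] is represented by 'I_n. *)
From HB Require Import structures.
From mathcomp Require Import all_boot all_order all_algebra.

Set Implicit Arguments.
Unset Strict Implicit.
Unset Printing Implicit Defensive.

Definition latin_square (n : nat) (L : 'M['I_n]_n) : bool :=
  [forall i, forall k, #|[set j | L i j == k]| == 1] &&
  [forall j, forall k, #|[set i | L i j == k]| == 1].

(* The box in position (a, b) of the w x h grid of boxes
   has rows a * h, ..., a * h + h - 1 and columns b * w, ..., b * w + w - 1. *)
Definition box (h w : nat) (a : 'I_w) (b : 'I_h) :
    {set 'I_(h * w) * 'I_(h * w)} :=
  [set c : 'I_(h * w) * 'I_(h * w) |
    (a * h <= c.1 < a.+1 * h) && (b * w <= c.2 < b.+1 * w)].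

Definition sudoku_squares (h w : nat) : {set 'M['I_(h * w)]_(h * w)} :=
  [set L | latin_square L &&
    [forall a : 'I_w, forall b : 'I_h, forall k : 'I_(h * w),
       #|[set c in box a b | L c.1 c.2 == k]| == 1]].

Definition latin_inter (n : nat) (L L' : 'M['I_n]_n) :
    {set 'I_n * 'I_n * 'I_n} :=
  [set t | (L t.1.1 t.1.2 == t.2) && (L' t.1.1 t.1.2 == t.2)].

Definition intersection_sizes (h w : nat) : pred nat :=
  [pred m | [exists L in sudoku_squares h w, exists L' in sudoku_squares h w,
               #|latin_inter L L'| == m]].

(* {0, ..., n^2 - 6, n^2 - 4, n^2}, written additively because subtraction on
   nat is truncated. *)
Definition Upsilon (n : nat) : pred nat :=
  [pred m | [|| m + 6 <= n ^ 2, m + 4 == n ^ 2 | m == n ^ 2]].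

(* Main.v *)
Require Import Defs.
From HB Require Import structures.
From mathcomp Require Import all_boot all_order all_algebra all_fingroup.
From mathcomp Require Import zify ring.

(** Counting disagreements is more convenient than counting agreements: call
    [d] a defect of type [(h, w)] if two Sudoku latin squares of this type
    differ in exactly [d] cells.  Writing [n = h * w], the claim is that the
    defects are the numbers [d <= n ^ 2] other than 1, 2, 3, 5, except that
    type [(2, 2)] also misses 6, 9 and 11.

    Necessity.  Two permutations never differ in exactly one place, so every
    row and every column contains no disagreement or at least two.  Fewer than
    six disagreements therefore lie in at most two rows, hence every column
    that meets them contains exactly two; their number is then even, and it
    cannot be two because a single column would leave one disagreement in a row
    ([admissible_support]).  The three further exceptions for type [(2, 2)] are
    excluded by listing all squares.

    Sufficiency rests on a product construction ([sudoku_defect_inflate]).  In a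
    Sudoku square of type [(k * h, w)] of the right shape, the cells fall into
    [k ^ 2] subarrays that may be filled independently with arbitrary Sudoku
    squares of type [(h, w)]; so sums of [k ^ 2] defects of type [(h, w)] are
    defects of type [(k * h, w)].  A Sudoku square of type [(1, w)] is a latin
    square of order [w], so every sum of [h ^ 2] defects of latin squares of
    order [w] is a defect of type [(h, w)].  As transposition exchanges [h] and
    [w], the larger of the two may be taken for [w].

    For [w >= 5] a few latin defects suffice ([sums_four]).  By Hall's theorem
    every latin rectangle extends to a latin square, so a change within two or
    three rows that preserves the set of symbols in each column can be
    prescribed in those rows alone.  Swapping two rows on [t] columns and
    rotating [k] other rows gives [2 * t + w * k]; changes in three rows give 7
    and 9; and the sum table of the integers modulo [w], compared with a relabelled
    copy of itself, gives [w ^ 2 - 1].  Four such numbers add up to any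
    admissible number up to [4 * w ^ 2], and each further subarray contributes
    [0] or [w ^ 2].

    For [w <= 4] the few remaining types are treated with explicit squares. *)

Set Implicit Arguments.
Unset Strict Implicit.
Unset Printing Implicit Defensive.

(** * Sudoku squares over arbitrary coordinates *)

Section Sudoku.
Variables A R B C S : finType.

(** A row is a pair (band, row of the band) and a column is a pair (stack, column of
    the stack), so a box is given by a band and a stack.  Injectivity in every
    row, column and box is the Sudoku property as soon as [S] has the right
    size.  Arbitrary finite types instead of ordinals let the product
    construction use pairs as coordinates and symbols without any arithmetic. *)
Definition is_sudoku (f : A * R -> B * C -> S) : Prop :=
  [/\ forall x, injective (f x), forall y, injective (f^~ y)
    & forall a b, injective (fun z : R * C => f (a, z.1) (b, z.2))].

Definition defect (f g : A * R -> B * C -> S) : nat :=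
  \sum_x \sum_y (f x y != g x y).

Definition has_defect (d : nat) : Prop :=
  exists f g, [/\ is_sudoku f, is_sudoku g & defect f g = d].
End Sudoku.

Arguments has_defect : clear implicits.

Lemma bijection_eq_card (T T' : finType) :
  #|T| = #|T'| -> exists phi : T -> T', bijective phi.
Proof.
move=> e; pose phi x := enum_val (cast_ord e (enum_rank x)).
exists phi; apply: inj_card_bij; rewrite ?e //.
by move=> x y /enum_val_inj /cast_ord_inj /enum_rank_inj.
Qed.

Lemma has_defect_transfer (A A' R R' B B' C C' S S' : finType) (d : nat) :
  #|A| = #|A'| -> #|R| = #|R'| -> #|B| = #|B'| -> #|C| = #|C'| -> #|S| = #|S'| ->
  has_defect A R B C S d -> has_defect A' R' B' C' S' d.
Proof.
move=> /esym/bijection_eq_card[pa pab] /esym/bijection_eq_card[pr prb].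
move=> /esym/bijection_eq_card[pb pbb] /esym/bijection_eq_card[pc pcb].
move=> /bijection_eq_card[ps /bij_inj psi] [f [g [sf sg <-]]].
have [pai pri] := (bij_inj pab, bij_inj prb).
have [pbi pci] := (bij_inj pbb, bij_inj pcb).
pose px (x : A' * R') := (pa x.1, pr x.2).
pose py (y : B' * C') := (pb y.1, pc y.2).
have pxi : injective px by move=> [? ?] [? ?] [/pai-> /pri->].
have pyi : injective py by move=> [? ?] [? ?] [/pbi-> /pci->].
pose recode (f : A * R -> B * C -> S) x y := ps (f (px x) (py y)).
have recode_sudoku k : is_sudoku k -> is_sudoku (recode k).
  case=> k1 k2 k3; split.
  - by move=> x y y' /psi /k1 /pyi.
  - by move=> y x x' /psi /k2 /pxi.
  move=> a b [r c] [r' c'] /psi e.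
  by have [/pri-> /pci->] := k3 (pa a) (pb b) (pr r, pc c) (pr r', pc c') e.
exists (recode f), (recode g); split; [exact: recode_sudoku.. |].
have px_bij : bijective px.
  case: pab prb => [qa qaK paK] [qr qrK prK].
  by exists (fun x => (qa x.1, qr x.2)) => -[x y]; rewrite /px /= ?qaK ?qrK ?paK ?prK.
have py_bij : bijective py.
  case: pbb pcb => [qa qaK paK] [qr qrK prK].
  by exists (fun x => (qa x.1, qr x.2)) => -[x y]; rewrite /py /= ?qaK ?qrK ?paK ?prK.
rewrite /defect [RHS](reindex px) /=; last exact: onW_bij.
apply: eq_bigr => x _; rewrite [RHS](reindex py) /=; last exact: onW_bij.
by apply: eq_bigr => y _; rewrite /recode (inj_eq psi).
Qed.

Lemma has_defect_transpose (A R B C S : finType) (d : nat) :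
  has_defect A R B C S d -> has_defect B C A R S d.
Proof.
move=> [f [g [sf sg <-]]].
have sT k : is_sudoku k -> is_sudoku (fun y x => k x y).
  case=> k1 k2 k3; split => //.
  move=> b a [c r] [c' r'] /= e.
  by have [-> ->] := k3 a b (r, c) (r', c') e.
exists (fun y x => f x y), (fun y x => g x y); split; [exact: sT.. |].
by rewrite /defect exchange_big.
Qed.

Lemma sum_pair (T U : finType) (F : T * U -> nat) :
  \sum_x F x = \sum_t \sum_u F (t, u).
Proof. by rewrite pair_bigA; apply: eq_bigr => -[]. Qed.

(** The cells [((a, (p, r)), ((q, b), c))] with fixed [p] and [q] form a subarray,
    filled with the symbols [(op p q, s)].  As [op] is a latin square, two
    subarrays that share a row, a column or a box use disjoint sets of symbols:
    the subarrays do not interact, and each of them may carry its own pair of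
    Sudoku squares. *)
Lemma has_defect_inflate (K A R B C S : finType) (op : K -> K -> K) (d : K -> K -> nat) :
  (forall p, injective (op p)) -> (forall q, injective (op^~ q)) ->
  (forall p q, has_defect A R B C S (d p q)) ->
  has_defect A (K * R)%type (K * B)%type C (K * S)%type (\sum_p \sum_q d p q).
Proof.
move=> opl opr dP.
have /fin_all_exists[f /fin_all_exists[g fgP]] :
    forall pq : K * K, exists f g,
      [/\ @is_sudoku A R B C S f, is_sudoku g & defect f g = d pq.1 pq.2].
  by move=> [p q]; apply: dP.
pose glue (f : K * K -> A * R -> B * C -> S) (x : A * (K * R)) (y : (K * B) * C) :=
  (op x.2.1 y.1.1, f (x.2.1, y.1.1) (x.1, x.2.2) (y.1.2, y.2)).
have glueP k : (forall pq, is_sudoku (k pq)) -> is_sudoku (glue k).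
  move=> kP; split.
  - move=> [a [p r]] [[q b] c] [[q' b'] c'] [/opl /= <-] e.
    by case: (kP (p, q)) => k1 _ _; have [-> ->] := k1 _ _ _ e.
  - move=> [[q b] c] [a [p r]] [a' [p' r']] [/opr /= <-] e.
    by case: (kP (p, q)) => _ k2 _; have [-> ->] := k2 (b, c) _ _ e.
  move=> a [q b] [[p r] c] [[p' r'] c'] [/opr /= <-] e.
  by case: (kP (p, q)) => _ _ k3; have [-> ->] := k3 a b (r, c) (r', c') e.
exists (glue f), (glue g); split; [by apply: glueP => pq; case: (fgP pq).. |].
transitivity (\sum_p \sum_q defect (f (p, q)) (g (p, q))); last first.
  by apply: eq_bigr => p _; apply: eq_bigr => q _; case: (fgP (p, q)).
rewrite /defect sum_pair.
under eq_bigr => a _ do (rewrite sum_pair; under eq_bigr => p _ do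
  (under eq_bigr => r _ do rewrite sum_pair sum_pair; rewrite exchange_big)).
rewrite exchange_big; apply: eq_bigr => p _.
rewrite exchange_big; apply: eq_bigr => q _.
rewrite sum_pair; apply: eq_bigr => a _; apply: eq_bigr => r _.
rewrite sum_pair; apply: eq_bigr => b _; apply: eq_bigr => c _.
by rewrite /glue /= xpair_eqE eqxx.
Qed.

Definition sudoku_defect (h w d : nat) : Prop :=
  has_defect 'I_w 'I_h 'I_h 'I_w 'I_(h * w) d.

Lemma sudoku_defect_transpose h w d : sudoku_defect h w d -> sudoku_defect w h d.
Proof.
move=> /has_defect_transpose; apply: has_defect_transfer => //.
by rewrite !card_ord mulnC.
Qed.

Definition sums (P : nat -> Prop) (k d : nat) : Prop :=
  exists s, [/\ size s = k, (forall x, x \in s -> P x) & sumn s = d].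

Lemma sudoku_defect_inflate h w k d : 0 < k ->
  sums (sudoku_defect h w) (k ^ 2) d -> sudoku_defect (k * h) w d.
Proof.
case: k => // k _ [s [szs sP <-]].
have -> : sumn s = \sum_(p < k.+1) \sum_(q < k.+1) nth 0 s (p * k.+1 + q).
  rewrite sumnE (big_nth 0) szs expnS expn1 big_nat_mul big_mkord.
  apply: eq_bigr => p _; rewrite -{1}[p * k.+1]add0n big_addn mulSn addnK.
  by rewrite big_mkord; apply: eq_bigr => q _; rewrite addnC.
pose add := fun p q : 'I_k.+1 => (p + q)%R.
apply: (has_defect_transfer _ _ _ _ _
  (@has_defect_inflate 'I_k.+1 'I_w 'I_h 'I_h 'I_w 'I_(h * w) add
     (fun p q => nth 0 s (p * k.+1 + q)) (@GRing.addrI _) (@GRing.addIr _) _)).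
1-5: by rewrite ?card_prod ?card_ord ?mulnA.
move=> p q; apply: sP; apply: mem_nth; rewrite szs.
by have := ltn_ord p; have := ltn_ord q; nia.
Qed.

Definition admissible (d : nat) : bool := d \notin [:: 1; 2; 3; 5].

(** * Numbered rows and columns *)

Lemma unique_preimagesP (T U : finType) (f : T -> U) : #|T| = #|U| ->
  reflect (injective f) [forall k, #|[set j | f j == k]| == 1].
Proof.
move=> eTU; apply: (iffP forallP) => [f1 x y exy | fI k].
  have /cards1P[z /setP fz] := f1 (f x).
  by have := fz x; have := fz y; rewrite !inE exy eqxx => /esym/eqP-> /esym/eqP->.
have [g fK gK] : bijective f by apply: inj_card_bij; rewrite ?eTU.
apply/cards1P; exists (g k); apply/setP => j; rewrite !inE.
by rewrite (can2_eq fK gK).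
Qed.

Lemma block_index_proof (m n : nat) (x : 'I_m * 'I_n) : x.1 * n + x.2 < m * n.
Proof. by case: x => a r /=; have := ltn_ord a; have := ltn_ord r; nia. Qed.

Definition block_index (m n : nat) (x : 'I_m * 'I_n) : 'I_(m * n) :=
  Ordinal (block_index_proof x).

Lemma block_index_inj (m n : nat) : injective (@block_index m n).
Proof.
move=> [a r] [a' r'] /(congr1 val) /= e.
have ltr := ltn_ord r; have ltr' := ltn_ord r'.
have /(congr1 (divn^~ n)) := e; have /(congr1 (modn^~ n)) := e.
rewrite !modnMDl !modn_small // => er.
have n_gt0 : 0 < n by apply: leq_ltn_trans ltr.
rewrite !divnMDl // !divn_small // !addn0 => ea.
by congr pair; apply: val_inj.
Qed.

Section Bridge.
Variables h w : nat.
Local Notation n := (h * w).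

Definition row_of (x : 'I_w * 'I_h) : 'I_n := cast_ord (mulnC w h) (block_index x).
Definition col_of (y : 'I_h * 'I_w) : 'I_n := block_index y.

Lemma row_of_inj : injective row_of.
Proof. by move=> x y /cast_ord_inj /block_index_inj. Qed.

Lemma row_of_bij : bijective row_of.
Proof. by apply: inj_card_bij; [exact: row_of_inj | rewrite card_prod !card_ord mulnC]. Qed.

Lemma col_of_bij : bijective col_of.
Proof. by apply: inj_card_bij; [exact: block_index_inj | rewrite card_prod !card_ord]. Qed.

Definition in_boxes (L : 'M['I_n]_n) (x : 'I_w * 'I_h) (y : 'I_h * 'I_w) : 'I_n :=
  L (row_of x) (col_of y).

(** The box in position [(a, b)] is the image of ['I_h * 'I_w] under the two
    numberings, so counting in a box is counting over in-box coordinates. *)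
Lemma card_box (L : 'M['I_n]_n) a b k :
  #|[set c in box a b | L c.1 c.2 == k]|
    = #|[set z : 'I_h * 'I_w | in_boxes L (a, z.1) (b, z.2) == k]|.
Proof.
pose F (z : 'I_h * 'I_w) := (row_of (a, z.1), col_of (b, z.2)).
have F_inj : injective F.
  move=> [r c] [r' c'] e; have /= /row_of_inj [->] := congr1 fst e.
  by have /= /block_index_inj [->] := congr1 snd e.
rewrite -[RHS](card_imset _ F_inj); apply: eq_card => -[i j].
apply/idP/imsetP => [|[[r c] + [-> ->]]]; rewrite !inE /=; last first.
  move=> ->; rewrite andbT; have := ltn_ord r; have := ltn_ord c; lia.
case/andP=> /andP[/andP[ai ia] /andP[bj jb]] Lk.
have rP : i - a * h < h by lia.
have cP : j - b * w < w by lia.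
have ei : i = row_of (a, Ordinal rP) by apply: val_inj => /=; lia.
have ej : j = col_of (b, Ordinal cP) by apply: val_inj => /=; lia.
by exists (Ordinal rP, Ordinal cP); rewrite ?inE /F /= /in_boxes -ei -ej.
Qed.

Lemma sudoku_squaresP (L : 'M['I_n]_n) :
  reflect (is_sudoku (in_boxes L)) (L \in sudoku_squares h w).
Proof.
have card_bc : #|{: 'I_h * 'I_w}| = #|'I_n| by rewrite card_prod !card_ord.
have fP (f : 'I_n -> 'I_n) := unique_preimagesP f (erefl _).
rewrite inE; apply: (iffP andP) => [[/andP[Lr Lc] Lb] | [Lr Lc Lb]]; split.
- move=> x y y' /(elimT (fP _) (forallP Lr _)); exact: block_index_inj.
- by move=> y x x' /(elimT (fP (L ^~ _)) (forallP Lc _)) /row_of_inj.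
- move=> a b; apply/(unique_preimagesP _ card_bc)/forallP => k.
  by rewrite -card_box; move/forallP/(_ a)/forallP/(_ b)/forallP/(_ k): Lb.
- have [rK Kr rrK] := row_of_bij; have [cK Kc ccK] := col_of_bij.
  apply/andP; split; apply/forallP=> i.
    apply/(fP (L i)) => j j'; rewrite -[i]rrK -[j]ccK -[j']ccK => /Lr; congruence.
  apply/(fP (L^~ i)) => j j'; rewrite -[i]ccK -[j]rrK -[j']rrK => /Lc; congruence.
apply/forallP=> a; apply/forallP=> b; apply/forallP=> k; rewrite card_box.
by move: k; apply/forallP/(unique_preimagesP _ card_bc).
Qed.

Lemma sum_row_col (F : 'I_n -> 'I_n -> nat) :
  \sum_x \sum_y F (row_of x) (col_of y) = \sum_i \sum_j F i j.
Proof.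
rewrite [RHS](reindex row_of) /=; last exact/onW_bij/row_of_bij.
apply: eq_bigr => x _; rewrite [RHS](reindex col_of) //=.
exact/onW_bij/col_of_bij.
Qed.

Lemma latin_inter_defect (L L' : 'M['I_n]_n) :
  #|latin_inter L L'| + defect (in_boxes L) (in_boxes L') = n ^ 2.
Proof.
pose F (p : 'I_n * 'I_n) := (p, L p.1 p.2).
have F_inj : injective F by move=> p p' [].
have -> : latin_inter L L' = F @: [set p | L p.1 p.2 == L' p.1 p.2].
  apply/setP => -[[i j] k]; rewrite !inE /=; apply/andP/imsetP.
    by case=> /eqP e /eqP e'; exists (i, j); rewrite ?inE /F /= ?e ?e'.
  by case=> -[i' j']; rewrite inE /= => /eqP e [-> -> ->]; rewrite -e.
have -> : defect (in_boxes L) (in_boxes L') = #|~: [set p | L p.1 p.2 == L' p.1 p.2]|.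
  rewrite -sum1_card [RHS]big_mkcond [RHS]sum_pair /= -sum_row_col.
  apply: eq_bigr => x _; apply: eq_bigr => y _; rewrite !inE /in_boxes.
  by case: eqP.
by rewrite card_imset // cardsC card_prod !card_ord.
Qed.

Lemma intersection_sizesP m :
  reflect (exists2 d, sudoku_defect h w d & m + d = n ^ 2)
          (m \in intersection_sizes h w).
Proof.
apply: (iffP existsP) => [[L /andP[sL /existsP[L' /andP[sL' /eqP <-]]]]|].
  exists (defect (in_boxes L) (in_boxes L')); last exact: latin_inter_defect.
  by exists (in_boxes L), (in_boxes L'); split=> //; apply/sudoku_squaresP.
case=> d [f [g [sf sg <-]]] m_eq.
have [rK Kr rrK] := row_of_bij; have [cK Kc ccK] := col_of_bij.
pose mx (f : _ -> _ -> 'I_n) : 'M_n := (\matrix_(i, j) f (rK i) (cK j))%R.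
have mxE k x y : in_boxes (mx k) x y = k x y by rewrite /in_boxes mxE Kr Kc.
have mxP k : is_sudoku k -> mx k \in sudoku_squares h w.
  case=> k1 k2 k3; apply/sudoku_squaresP; split=> [x y y'|y x x'|a b z z'] /=; rewrite !mxE.
  - exact: k1.
  - exact: k2.
  - exact: k3.
exists (mx f); rewrite mxP //=; apply/existsP; exists (mx g); rewrite mxP //=.
rewrite -(eqn_add2r (defect f g)) m_eq -(latin_inter_defect (mx f) (mx g)).
by apply/eqP; congr addn; apply: eq_bigr => x _; apply: eq_bigr => y _; rewrite !mxE.
Qed.
End Bridge.

(** * Impossible numbers of disagreements *)

(** If [f] and [g] differ at [y0], they also differ at the place where [f] takes the
    value [g y0]. *)
Lemma injective_diff_neq1 (T U : finType) (f g : T -> U) : #|T| = #|U| ->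
  injective f -> injective g -> \sum_y (f y != g y) != 1.
Proof.
move=> eTU fI gI; apply/eqP => s1.
have /existsP[y0 fg0] : [exists y, f y != g y].
  apply: contraT => /existsPn h; move: s1; rewrite big1 // => y _.
  by rewrite (negPf (h y)).
have [fK Kf fKK] : bijective f by apply: inj_card_bij; rewrite ?eTU.
pose y1 := fK (g y0).
have y10 : y1 != y0 by apply: contraNneq fg0 => e; rewrite -{1}e fKK.
move: s1; rewrite (bigD1 y0) //= fg0 (bigD1 y1) //=.
have -> : f y1 != g y1 by rewrite fKK (inj_eq gI) eq_sym.
by rewrite addnA.
Qed.

(** A support with fewer than six elements meets at most two rows, so every column
    that it meets contains exactly two of its elements.  Its size is then even;
    and if it meets only one row, a column cannot contain two elements. *)
Lemma admissible_support (X Y : finType) (e : X -> Y -> bool) (d : nat) :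
  (forall x, \sum_y e x y != 1) -> (forall y, \sum_x e x y != 1) ->
  \sum_x \sum_y e x y = d -> admissible d.
Proof.
move=> row1 col1 dE.
(* P is the set of rows that meet the support. *)
pose P := [pred x | 0 < \sum_y e x y].
have P2 : 2 * #|P| <= d.
  rewrite -dE -sum1_card big_distrr [X in _ <= X](bigID P) /=.
  apply: leq_trans (leq_addr _ _); apply: leq_sum => x; rewrite inE => ?.
  by have := row1 x; lia.
have col_le y : \sum_x e x y <= #|P|.
  rewrite -sum1_card [X in X <= _](bigID P) /= [X in _ + X]big1 ?addn0.
    by apply: leq_sum => x _; case: (e x y).
  move=> x; rewrite -eqn0Ngt sum_nat_eq0 => /forallP/(_ y)/=.
  by case: (e x y).
have dC : d = \sum_y \sum_x e x y by rewrite exchange_big.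
have d_one_row : #|P| <= 1 -> d = 0.
  move=> P1; rewrite dC big1 // => y _; have := col_le y; have := col1 y; lia.
have d_even : #|P| <= 2 -> ~~ odd d.
  move=> Ple; rewrite dC; apply: (big_ind (fun m => ~~ odd m)) => // [x y|y _].
    by rewrite oddD; case: odd.
  by have := col_le y; have := col1 y; case: (\sum_x _) => [|[|[]]] //; lia.
clear dE dC; rewrite /admissible !inE; apply/negP => d1235.
have Ple : #|P| <= 2 by case/or4P: d1235 P2 => /eqP-> ; lia.
have d5 : d = 5.
  have := d_even Ple; have := d_one_row; case/or4P: d1235 P2 => /eqP-> // P2 d0 _.
  by suff: 2 = 0 by []; apply: d0; lia.
by have := d_even Ple; rewrite d5.
Qed.

Lemma sudoku_defect_necessary h w d :
  sudoku_defect h w d -> d <= (h * w) ^ 2 /\ admissible d.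
Proof.
case=> f [g [[f1 f2 f3] [g1 g2 g3] dE]]; split.
  rewrite -dE; apply: (@leq_trans (\sum_(x : 'I_w * 'I_h) \sum_(y : 'I_h * 'I_w) 1)).
    by apply: leq_sum => x _; apply: leq_sum => y _; case: eqP.
  by rewrite !sum_nat_const !card_prod !card_ord; lia.
apply: admissible_support dE => [x|y].
  by apply: injective_diff_neq1 => //; rewrite card_prod !card_ord.
apply: (@injective_diff_neq1 _ _ (f^~ y) (g^~ y)) => //.
by rewrite card_prod !card_ord mulnC.
Qed.

(** * Completion of latin rectangles *)

Definition neighbours (X Y : finType) (e : X -> Y -> bool) (J : {set X}) : {set Y} :=
  [set y | [exists x in J, e x y]].

Lemma neighboursU (X Y : finType) (e : X -> Y -> bool) (J K : {set X}) :
  neighbours e (J :|: K) = neighbours e J :|: neighbours e K.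
Proof.
apply/setP => y; rewrite !inE; apply/existsP/orP.
  by case=> x /andP[/setUP[xJ|xK] exy]; [left|right]; apply/existsP; exists x; apply/andP.
by case=> /existsP[x /andP[xJK exy]]; exists x; rewrite inE xJK ?orbT.
Qed.

(** Hall's marriage theorem, by induction on [#|D|].  If some proper nonempty [J] in [D]
    has only [#|J|] neighbours, match [J] with its neighbours and [D :\: J] with
    the other elements of [Y].  Otherwise every such [J] has a neighbour to
    spare, so any single edge may be matched and removed. *)
Lemma hall_on (X Y : finType) (y0 : Y) (e : X -> Y -> bool) (D : {set X}) :
  (forall J : {set X}, J \subset D -> #|J| <= #|neighbours e J|) ->
  exists2 p : X -> Y, {in D &, injective p} & {in D, forall x, e x (p x)}.
Proof.
have [m] := ubnP #|D|; elim: m e D => // m IH e D ltDm hall.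
have [-> | [x xD]] := set_0Vmem D.
  by exists (fun=> y0) => x; rewrite inE.
(* Deleting F from the right-hand side deletes it from every neighbourhood. *)
have remove (F : {set Y}) (K : {set X}) :
    neighbours (fun x y => e x y && (y \notin F)) K = neighbours e K :\: F.
  apply/setP => y; rewrite !inE; apply/existsP/andP.
    by case=> z /and3P[zK ezy yF]; split=> //; apply/existsP; exists z; apply/andP.
  by case=> yF /existsP[z /andP[zK ezy]]; exists z; apply/and3P.
(* J is matched into F and the rest of D outside F. *)
have glue (J : {set X}) (F : {set Y}) : J \subset D ->
    (exists2 p : X -> Y, {in J &, injective p} & {in J, forall x, e x (p x) && (p x \in F)}) ->
    (exists2 p : X -> Y, {in D :\: J &, injective p} &
       {in D :\: J, forall x, e x (p x) && (p x \notin F)}) ->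
    exists2 p : X -> Y, {in D &, injective p} & {in D, forall x, e x (p x)}.
  move=> JD [p pI pe] [q qI qe]; exists (fun x => if x \in J then p x else q x).
    move=> u v uD vD; case: ifPn => uJ; case: ifPn => vJ.
    - exact: pI.
    - move=> epq; have /andP[_] := pe u uJ; have /andP[_] := qe v ltac:(by rewrite !inE vJ).
      by rewrite epq => /negPf->.
    - move=> epq; have /andP[_] := pe v vJ; have /andP[_] := qe u ltac:(by rewrite !inE uJ).
      by rewrite epq => /negPf->.
    - by apply: qI; rewrite inE ?uJ ?vJ.
  move=> u uD; case: ifPn => uJ; first by case/andP: (pe u uJ).
  by have /andP[] := qe u ltac:(by rewrite !inE uJ).
case: (boolP [exists J : {set X},
    [&& J \subset D, J != set0, J != D & #|J| == #|neighbours e J|]]).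
  case/existsP=> J /and4P[JD J0 JnD /eqP cJ].
  have J_gt0 : 0 < #|J| by rewrite card_gt0.
  have ltJD : #|J| < #|D| by apply: proper_card; rewrite properEneq JnD.
  apply: (glue J (neighbours e J) JD).
    have [||p pI pe] := IH e J; first exact: leq_trans ltJD _.
      by move=> K KJ; apply: hall (subset_trans KJ JD).
    exists p => // u uJ; rewrite pe // inE; apply/existsP; exists u.
    by rewrite uJ pe.
  apply: (IH (fun x y => e x y && (y \notin neighbours e J))) => [|K KD].
    by rewrite cardsD (setIidPr JD); lia.
  rewrite remove.
  have := hall (J :|: K); rewrite neighboursU subUset JD.
  rewrite (subset_trans KD (subsetDl _ _)) => /(_ isT).
  have disJK : J :&: K = set0.
    apply/setP => z; rewrite !inE; apply/negP => /andP[zJ /(subsetP KD)].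
    by rewrite inE zJ.
  rewrite !cardsU disJK cards0 cardsD setIC.
  have := subset_leq_card (subsetIl (neighbours e K) (neighbours e J)); lia.
move/existsPn => tight.
have /set0Pn[y yN] : neighbours e [set x] != set0.
  rewrite -card_gt0; apply: leq_trans (hall _ _); first by rewrite cards1.
  by rewrite sub1set.
apply: (glue [set x] [set y]); first by rewrite sub1set.
  exists (fun=> y) => [u v /set1P-> /set1P-> //|u /set1P->]; rewrite set11 andbT.
  by move: yN; rewrite inE => /existsP[z /andP[/set1P->]].
apply: (IH (fun x' y' => e x' y' && (y' \notin [set y]))) => [|K KD].
  by move: (cardsD1 x D); rewrite xD; lia.
rewrite remove.
have [-> | K0] := eqVneq K set0; first by rewrite cards0.
have KD' := subset_trans KD (subsetDl _ _).
have KnD : K != D by apply: contraTneq KD => ->; apply/subsetPn; exists x => //; rewrite !inE eqxx.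
have := tight K; have := hall K KD'; rewrite KD' K0 KnD /=.
have := cardsD1 y (neighbours e K); case: (y \in _) => /=; lia.
Qed.

Lemma hall (X Y : finType) (y0 : Y) (e : X -> Y -> bool) :
  (forall J : {set X}, #|J| <= #|neighbours e J|) ->
  exists2 p : X -> Y, injective p & forall x, e x (p x).
Proof.
move=> hall; have [p pI pe] := @hall_on X Y y0 e setT (fun J _ => hall J).
by exists p => [x y|x]; [apply: pI | apply: pe]; rewrite inE.
Qed.

(** Counting the edges between [J] and its neighbours from both sides gives
    [#|J| * r <= #|neighbours e J| * r]. *)
Lemma regular_hall (X Y : finType) (y0 : Y) (e : X -> Y -> bool) (r : nat) : 0 < r ->
  (forall x, r <= \sum_y e x y) -> (forall y, \sum_x e x y <= r) ->
  exists2 p : X -> Y, injective p & forall x, e x (p x).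
Proof.
move=> r_gt0 degX degY; apply: hall y0 _ _ => J.
rewrite -(leq_pmul2r r_gt0) -!sum_nat_const.
apply: (@leq_trans (\sum_(x in J) \sum_y e x y)); first by apply: leq_sum => x _.
rewrite exchange_big [X in X <= _](bigID (mem (neighbours e J))) /=.
rewrite [X in _ + X]big1 ?addn0.
  apply: leq_sum => y _; apply: leq_trans (degY y).
  by rewrite big_mkcond; apply: leq_sum => x _; case: ifP.
move=> y; rewrite inE => /existsPn h; rewrite big1 // => x xJ.
by have := h x; rewrite xJ /=; case: (e x y).
Qed.

Definition latin_rectangle (w k : nat) (L : 'I_w -> 'I_w -> 'I_w) : Prop :=
  (forall i : 'I_w, i < k -> injective (L i)) /\
  (forall (j i i' : 'I_w), i < k -> i' < k -> L i j = L i' j -> i = i').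

Lemma card_ord_lt (w k : nat) : k <= w -> \sum_(i < w) (i < k) = k.
Proof.
move=> kw; rewrite -(subnKC kw) big_split_ord /=.
rewrite (eq_bigr (fun=> 1)) => [|i _]; last by rewrite ltn_ord.
rewrite sum_nat_const card_ord muln1 big1 ?addn0 // => i _.
by rewrite ltnNge leq_addr.
Qed.

Lemma sum_nat_pred1 (T : finType) (x : T) : \sum_y (y == x) = 1.
Proof. by rewrite (bigD1 x) //= eqxx big1 // => y /negPf->. Qed.

(** A further row is a matching of columns with symbols that do not yet occur in them:
    each column misses [w - k] symbols and each symbol is missing from [w - k]
    columns. *)
Lemma latin_rectangle_extend (w k : nat) (L : 'I_w -> 'I_w -> 'I_w) : k < w ->
  latin_rectangle k L ->
  exists2 L', latin_rectangle k.+1 L' & forall (i j : 'I_w), i < k -> L' i j = L i j.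
Proof.
move=> kw [Lr Lc].
pose used (j s : 'I_w) := [exists i : 'I_w, (i < k) && (L i j == s)].
have used_le j : \sum_s used j s <= k.
  rewrite -[X in _ <= X](card_ord_lt (ltnW kw)).
  apply: (@leq_trans (\sum_s \sum_(i < w) ((i < k) && (L i j == s)))).
    apply: leq_sum => s _; rewrite /used; case: existsP => // -[i iP].
    by rewrite (bigD1 i) //= iP.
  rewrite exchange_big; apply: leq_sum => i _ /=.
  case: (i < k) => /=; last by rewrite big1.
  by rewrite (eq_bigr (fun s => nat_of_bool (s == L i j))) ?sum_nat_pred1 // => s _; rewrite eq_sym.
have used_ge s : k <= \sum_j used j s.
  rewrite -[X in X <= _](card_ord_lt (ltnW kw)).
  apply: (@leq_trans (\sum_j \sum_(i < w) ((i < k) && (L i j == s)))).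
    rewrite exchange_big; apply: leq_sum => i _ /=; case: ltnP => //= ik.
    have [M LM ML] := injF_bij (Lr i ik).
    by rewrite (bigD1 (M s)) //= ML eqxx.
  apply: leq_sum => j _; rewrite /used; case: existsP => [[i /andP[ik /eqP iP]]|no].
    apply: (@leq_trans (\sum_i' (i' == i))); last by rewrite sum_nat_pred1.
    apply: leq_sum => i' _.
    case: ltnP => //= ik'; case: eqP => //= e'.
    by rewrite (Lc j i' i) ?eqxx // e' iP.
  rewrite big1 // => i _; case: (boolP (_ && _)) => // iP; case: no; by exists i.
have neg (F : 'I_w -> bool) : \sum_j ~~ F j = w - \sum_j F j.
  have : \sum_j (F j + ~~ F j) = w.
    by rewrite (eq_bigr (fun=> 1)) => [|j _]; [rewrite sum_nat_const card_ord muln1 | case: (F j)].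
  by rewrite big_split /=; lia.
have [|||p pI pP] := @regular_hall _ _ (Ordinal kw) (fun j s => ~~ used j s) (w - k).
- by rewrite subn_gt0.
- by move=> j; rewrite neg; have := used_le j; lia.
- by move=> s; rewrite neg; have := used_ge s; lia.
exists (fun i j : 'I_w => if i < k then L i j else p j); last by move=> i j ->.
split=> [i ik|j i i' ik ik'].
  by case: ltnP => // ki; apply: Lr.
case: ltnP => ki; case: ltnP => ki'.
- exact: Lc.
- by move=> e; case/existsP: (pP j); exists i; rewrite ki e eqxx.
- by move=> e; case/existsP: (pP j); exists i'; rewrite ki' e eqxx.
by move=> _; apply: val_inj => /=; lia.
Qed.

Lemma latin_rectangle_complete (w k : nat) (L : 'I_w -> 'I_w -> 'I_w) : k <= w ->
  latin_rectangle k L ->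
  exists2 L', latin_rectangle w L' & forall (i j : 'I_w), i < k -> L' i j = L i j.
Proof.
move=> kw; have [m mE] : exists m, m + k = w by exists (w - k); lia.
elim: m k L kw mE => [|m IH] k L kw mE Lk.
  by exists L => //; rewrite -{2}mE.
have [|L1 L1k L1E] := latin_rectangle_extend _ Lk; first lia.
have [||L2 L2w L2E] := IH k.+1 L1 _ _ L1k; [lia | lia |].
by exists L2 => // i j ik; rewrite L2E ?L1E //; lia.
Qed.

(** * Defects of latin squares *)

Definition is_latin (T : finType) (L : T -> T -> T) : Prop :=
  (forall i, injective (L i)) /\ (forall j, injective (L^~ j)).

(** For [h = 1] the bands have one row and the boxes are the rows. *)
Lemma latin_defect (T : finType) (L L' : T -> T -> T) :
  is_latin L -> is_latin L' ->
  sudoku_defect 1 #|T| (\sum_i \sum_j (L i j != L' i j)).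
Proof.
move=> latL latL'.
apply: (@has_defect_transfer T _ 'I_1 _ 'I_1 _ T _ T); rewrite ?card_ord ?mul1n //.
pose f (M : T -> T -> T) (x : T * 'I_1) (y : 'I_1 * T) := M x.1 y.2.
have fP M : is_latin M -> is_sudoku (f M).
  case=> Mr Mc; split.
  - by move=> [i p] [q j] [q' j'] /Mr /= ->; rewrite !ord1.
  - by move=> [q j] [i p] [i' p'] /Mc /= ->; rewrite !ord1.
  - by move=> i q [p j] [p' j'] /Mr /= ->; rewrite !ord1.
exists (f L), (f L'); split; [exact: fP.. |].
rewrite /defect sum_pair; apply: eq_bigr => i _.
by rewrite big_ord1 sum_pair big_ord1.
Qed.

(** Moving the entries within each column keeps the columns latin, and the two squares
    agree in cell [(i, j)] exactly when [rho j] fixes [i]. *)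
Lemma latin_move_rows (T : finType) (L : T -> T -> T) (rho : T -> T -> T) :
  is_latin L -> (forall j, injective (rho j)) ->
  (forall i, injective (fun j => L (rho j i) j)) ->
  sudoku_defect 1 #|T| (\sum_i \sum_j (rho j i != i)).
Proof.
move=> latL rhoI rowI; have [Lr Lc] := latL.
have latM : is_latin (fun i j => L (rho j i) j).
  by split=> // j i i' /Lc /rhoI.
have := latin_defect latM latL; congr (sudoku_defect 1 _ _).
by apply: eq_bigr => i _; apply: eq_bigr => j _; rewrite (inj_eq (Lc j)).
Qed.

(** In the integers modulo [w], compare [i + j] with [tau i + tau j + 2], where [tau]
    exchanges 0 and 1.  They agree when the displacements [tau i - i] and
    [tau j - j], which lie in [{0, 1, -1}], add up to [-2]; as 1, 2, 3, 4 are
    nonzero modulo [w], both displacements are then [-1], that is [i = j = 1]. *)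
Lemma latin_defect_all_but_one (w : nat) : 4 < w -> sudoku_defect 1 w (w ^ 2).-1.
Proof.
case: w => [|[|[|[|[|n]]]]] // _.
pose e : 'I_n.+4.+1 := inord 1.
have ke0 k : 0 < k < 5 -> (e *+ k != 0)%R.
  move=> k5; rewrite /e Zp_mulrn; apply/eqP => /(congr1 val) /=.
  by rewrite inordK ?mul1n ?modn_small; lia.
pose tau := tperm (0 : 'I_n.+4.+1)%R e.
pose L (i j : 'I_n.+4.+1) := (i + j)%R.
pose L' (i j : 'I_n.+4.+1) := (tau i + tau j + e *+ 2)%R.
have latL : is_latin L by split=> [i|j]; [exact: GRing.addrI | exact: GRing.addIr].
have latL' : is_latin L'.
  split=> [i j j' /GRing.addIr /GRing.addrI|j i i' /GRing.addIr /GRing.addIr];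
    exact: perm_inj.
have := latin_defect latL latL'; rewrite card_ord; congr sudoku_defect.
have e1 : e != 0%R := ke0 1 isT.
have agree i j : (L i j == L' i j) = (i == e) && (j == e).
  rewrite /L /L' /tau; apply/eqP/andP => [|[/eqP-> /eqP->]]; last first.
    by rewrite tpermR GRing.mulr2n !GRing.add0r.
  have no k x y : 0 < k < 5 -> x = y -> (y - x = e *+ k)%R -> False.
    by move=> /ke0/eqP ek0 -> /esym; rewrite GRing.subrr.
  case: tpermP => [->|->|_ _]; case: tpermP => [->|->|_ _] // h; exfalso.
  - by apply: (no 4 _ _ _ h) => //; ring.
  - by apply: (no 2 _ _ _ h) => //; ring.
  - by apply: (no 3 _ _ _ h) => //; ring.
  - by apply: (no 2 _ _ _ h) => //; ring.
  - by apply: (no 1 _ _ _ h) => //; ring.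
  - by apply: (no 3 _ _ _ h) => //; ring.
  - by apply: (no 1 _ _ _ h) => //; ring.
  - by apply: (no 2 _ _ _ h) => //; ring.
have total : \sum_i \sum_j ((L i j == L' i j) + (L i j != L' i j)) = n.+4.+1 ^ 2.
  under eq_bigr => i _ do under eq_bigr => j _ do rewrite addnC addn_negb.
  by rewrite !sum_nat_const !card_ord muln1.
have one : \sum_i \sum_j (L i j == L' i j) = 1.
  rewrite (bigD1 e) //= [X in _ + X]big1 => [|i /negPf ie]; last first.
    by apply: big1 => j _; rewrite agree ie.
  rewrite addn0 -[RHS](sum_nat_pred1 e); apply: eq_bigr => j _.
  by rewrite agree eqxx.
rewrite -total; under [in RHS]eq_bigr => i _ do rewrite big_split.
by rewrite big_split /= one.
Qed.

Definition rot_range (a n i : nat) : nat :=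
  if i < a then i else if i < a + n then (if i.+1 == a + n then a else i.+1) else i.

Lemma rot_range_spec a n i :
  [\/ i < a /\ rot_range a n i = i, a + n <= i /\ rot_range a n i = i,
      [/\ a <= i, i.+1 < a + n & rot_range a n i = i.+1]
    | [/\ a <= i, i.+1 = a + n & rot_range a n i = a]].
Proof.
rewrite /rot_range; case: ltnP => ia; first by constructor 1.
case: ltnP => ian; last by constructor 2.
by case: eqP => e; [constructor 4 | constructor 3; split=> //; lia].
Qed.

Lemma rot_range_inj a n : injective (rot_range a n).
Proof.
move=> i j.
by case: (rot_range_spec a n i) => [] [?]; case: (rot_range_spec a n j) => [] [?]; lia.
Qed.

Lemma rot_range_neq a n i : n != 1 -> (rot_range a n i != i) = (a <= i < a + n).
Proof. by case: (rot_range_spec a n i) => [] [?]; lia. Qed.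

Lemma rot_range_lt a n i c : a + n <= c -> (rot_range a n i < c) = (i < c).
Proof. by case: (rot_range_spec a n i) => [] [?]; lia. Qed.

Lemma rot_range_ge a n i : (a <= rot_range a n i) = (a <= i).
Proof. by case: (rot_range_spec a n i) => [] [?]; lia. Qed.

(** If the first [q] rows use on the first [t] columns only [t] symbols, they may be
    rotated there without disturbing the other columns; [k] more rows are rotated
    as wholes.  Such a rectangle of [q] rows consists of two cyclic rectangles
    side by side, of widths [t] and [w - t]; each is latin if it is empty or at
    least [q] wide. *)
Lemma latin_defect_rows w q t k : t <= w -> 1 < q -> q + k <= w -> k != 1 ->
  (t == 0) || (q <= t) -> (t == w) || (q <= w - t) ->
  sudoku_defect 1 w (q * t + w * k).
Proof.
move=> tw q_gt1 qkw k1 qt qwt.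
(* On the columns below t, and on the others, the first q rows are cyclic. *)
pose rect i j := if j < t then (i + j) %% t else t + (i + (j - t)) %% (w - t).
have rectP (i j : 'I_w) : rect i j < w.
  rewrite /rect; case: (ltnP j t) => jt.
    have : (i + j) %% t < t by rewrite ltn_pmod //; lia.
    lia.
  have : (i + (j - t)) %% (w - t) < w - t by rewrite ltn_pmod //; have := ltn_ord j; lia.
  lia.
pose R (i j : 'I_w) := Ordinal (rectP i j).
have qw : q <= w by lia.
have modI n a b c : a < n -> b < n -> (c + a) %% n = (c + b) %% n -> a = b.
  by move=> an bn /eqP; rewrite eqn_modDl !modn_small // => /eqP.
have rect_row i (j j' : 'I_w) : rect i j = rect i j' -> j = j'.
  rewrite /rect; have := ltn_ord j; have := ltn_ord j'.
  case: (ltnP j t) => jt; case: (ltnP j' t) => jt' ltj' ltj e; apply: val_inj => /=.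
  - exact: modI e.
  - have : (i + j) %% t < t by rewrite ltn_pmod; lia.
    lia.
  - have : (i + j') %% t < t by rewrite ltn_pmod; lia.
    lia.
  - have : j - t = j' - t by apply: (modI (w - t)); [lia | lia | apply: addnI e].
    lia.
have R_rect : latin_rectangle q R.
  split=> [i _ j j' /(congr1 val) /rect_row //|j i i' iq iq' /(congr1 val) /=].
  rewrite /rect; have ltj := ltn_ord j; case: (ltnP j t) => jt e; apply: val_inj => /=.
    by apply: (modI t _ _ j); [lia | lia | rewrite addnC e addnC].
  by apply: (modI (w - t) _ _ (j - t)); [lia | lia |
     rewrite ![j - t + _]addnC; apply: addnI e].
have [|L [Lr Lc] LR] := latin_rectangle_complete _ R_rect; first lia.
pose rot := rot_range.
(* The first q rows are rotated on the columns below t, the next k everywhere. *)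
pose step j i := if i < q then (if j < t then rot 0 q i else i) else rot q k i.
have stepP (j i : 'I_w) : step j i < w.
  by rewrite /step; case: (ltnP i q) => _; [case: (ltnP j t) => _|]; rewrite ?rot_range_lt //; lia.
pose rho (j i : 'I_w) := Ordinal (stepP j i).
have rot0 i : i < q -> rot 0 q i < q.
  by rewrite /rot rot_range_lt.
have rotq i : q <= i -> q <= rot q k i.
  by rewrite /rot rot_range_ge.
have rhoI j : injective (rho j).
  move=> i i' /(congr1 val) /=; rewrite /step => e; apply: val_inj => /=; move: e.
  case: (ltnP i q) => iq; case: (ltnP i' q) => iq'; case: (ltnP j t) => jt // e;
    try exact: (rot_range_inj e).
  - by have := rot0 _ iq; have := rotq _ iq'; lia.
  - by have := rotq _ iq'; lia.
  - by have := rot0 _ iq'; have := rotq _ iq; lia.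
  - by have := rotq _ iq; lia.
have rowI i : injective (fun j => L (rho j i) j).
  move=> j j'; case: (ltnP i q) => iq; last first.
    have -> : rho j' i = rho j i by apply: val_inj; rewrite /= /step ltnNge iq.
    exact: (Lr _ (ltn_ord _)).
  have rq j0 : rho j0 i < q.
    by rewrite /= /step iq; case: (ltnP j0 t) => // _; apply: rot0.
  rewrite !LR // => /(congr1 val) /=.
  have [jt|jt] := ltnP j t; have [jt'|jt'] := ltnP j' t.
  - by rewrite /step iq jt jt' => /rect_row.
  - rewrite /rect jt ltnNge jt' /=.
    have : (step j i + j) %% t < t by rewrite ltn_pmod; lia.
    lia.
  - rewrite /rect jt' ltnNge jt /=.
    have : (step j' i + j') %% t < t by rewrite ltn_pmod; lia.
    lia.
  - by rewrite /step iq !ltnNge jt jt' => /rect_row.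
have latL : is_latin L.
  by split=> [i|j i i']; [apply: Lr | apply: Lc].
have := latin_move_rows latL rhoI rowI; rewrite card_ord; congr sudoku_defect.
(* Adding the first q rows on both sides makes the count exact in each cell. *)
apply: (@addIn (w * q)); rewrite -addnA -mulnDr addnC.
rewrite [k + q]addnC -{1}(card_ord_lt qw) -[in RHS](card_ord_lt qkw).
have -> : q * t = \sum_(i < w) \sum_(j < w) (i < q) * (j < t).
  by under eq_bigr => i _ do rewrite -big_distrr; rewrite -big_distrl !card_ord_lt.
rewrite !big_distrr -!big_split /=; apply: eq_bigr => i _.
have cstw c : w * c = \sum_(j < w) c by rewrite sum_nat_const card_ord.
rewrite !cstw -!big_split; apply: eq_bigr => j _ /=.
suff -> : (rho j i != i) = (if i < q then j < t else i < q + k).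
  by case: ltnP => iq; rewrite ?mul1n ?mul0n; [rewrite addnC (leq_trans iq) ?leq_addr|].
rewrite -val_eqE /= /step /rot; case: (ltnP i q) => iq.
  by case: (ltnP j t) => _; rewrite ?eqxx // rot_range_neq ?iq //; lia.
by rewrite rot_range_neq ?iq.
Qed.

(** Three rows of width [w >= 6].  Among them the entries [1, 2] of column 1, [2, 3, 1]
    of column 2 and [1, 3] of column 0 can be permuted within their columns in
    such a way that every row keeps its symbols; these are seven cells. *)
Definition seven_rows (w i j : nat) : nat :=
  match i with
  | 0 => j
  | 1 => if j.+1 == w then 0 else j.+1
  | _ => match j with 0 => 3 | 1 => 0 | 2 => 1 | 3 => w.-1 | 4 => 2 | _ => j.-1 end
  end.

Variant row1_spec (w j : nat) : nat -> Type :=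
  | Row1Last of j.+1 = w : row1_spec w j 0
  | Row1Next of j.+1 < w : row1_spec w j j.+1.

Lemma row1P w j : j < w -> row1_spec w j (seven_rows w 1 j).
Proof.
by move=> jw; rewrite /seven_rows; case: eqP => ?; constructor; lia.
Qed.

Variant row2_spec (w j : nat) : nat -> Type :=
  | Row2_0 of j = 0 : row2_spec w j 3
  | Row2_1 of j = 1 : row2_spec w j 0
  | Row2_2 of j = 2 : row2_spec w j 1
  | Row2_3 of j = 3 : row2_spec w j w.-1
  | Row2_4 of j = 4 : row2_spec w j 2
  | Row2_5 of 4 < j : row2_spec w j j.-1.

Lemma row2P w j : row2_spec w j (seven_rows w 2 j).
Proof. by case: j => [|[|[|[|[|j]]]]]; constructor. Qed.

Lemma seven_rows_lt w i j : 5 < w -> j < w -> seven_rows w i j < w.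
Proof.
move=> w5 jw; case: i => [|[|i]] //; first by case: row1P => //; lia.
rewrite -[seven_rows _ _ _]/(seven_rows w 2 j).
by case: row2P => //; lia.
Qed.

Lemma seven_rows_inj w i j j' : 5 < w -> j < w -> j' < w ->
  seven_rows w i j = seven_rows w i j' -> j = j'.
Proof.
move=> w5 jw jw'; case: i => [|[|i]] //.
  by case: (row1P jw) => ?; case: (row1P jw') => ?; lia.
rewrite -![seven_rows _ i.+2 _]/(seven_rows w 2 _).
by case: (row2P w j) => ?; case: (row2P w j') => ?; lia.
Qed.

Lemma seven_cols_inj w i i' j : 5 < w -> j < w -> i < 3 -> i' < 3 ->
  seven_rows w i j = seven_rows w i' j -> i = i'.
Proof.
move=> w5 jw; have r1 := row1P jw; have r2 := row2P w j.
case: i => [|[|[|]]] //; case: i' => [|[|[|]]] // _ _.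
all: rewrite -1?[seven_rows w 0 j]/j; (try case: r1 => ?); (try case: r2 => ?); lia.
Qed.

(** The permutation of the rows that is applied in column [j]. *)
Definition seven_rho (j i : nat) : nat :=
  match j, i with
  | 0, 1 => 2 | 0, 2 => 1 | 1, 0 => 1 | 1, 1 => 0
  | 2, 0 => 2 | 2, 1 => 0 | 2, 2 => 1 | _, _ => i end.

Lemma seven_rho_lt3 j i : (seven_rho j i < 3) = (i < 3).
Proof. by case: j => [|[|[|j]]]; case: i => [|[|[|i]]]. Qed.

Lemma seven_rho_ge3 j i : 3 <= i -> seven_rho j i = i.
Proof. by case: j => [|[|[|j]]]; case: i => [|[|[|i]]]. Qed.

Lemma seven_rho_inj j : injective (seven_rho j).
Proof.
by move=> i i'; case: j => [|[|[|j]]] //; case: i => [|[|[|i]]] //; case: i' => [|[|[|i']]].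
Qed.

Lemma count_seven_rho m :
  \sum_(j < 3 + m) \sum_(i < 3 + m) (seven_rho j i != i) = 7.
Proof.
rewrite big_split_ord /= [X in _ + X]big1 ?addn0 => [|j _]; last first.
  by apply: big1 => i _; rewrite eqxx.
rewrite (eq_bigr (fun j : 'I_3 => \sum_(i < 3) (seven_rho j i != i))) => [|j _].
  by rewrite !big_ord_recl !big_ord0.
rewrite big_split_ord /= [X in _ + X]big1 ?addn0 // => i _.
by rewrite seven_rho_ge3 ?eqxx.
Qed.

(** The new row [i] is the old row [i] read through the permutation [seven_col i] of
    the columns, which makes its latinity evident. *)
Definition seven_col (i j : nat) : nat := match i, j with
  | 0, 1 => 2 | 0, 2 => 1
  | 1, 0 => 2 | 1, 1 => 0 | 1, 2 => 1
  | 2, 0 => 2 | 2, 2 => 0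
  | _, _ => j end.

Lemma seven_col_inj i : injective (seven_col i).
Proof.
by move=> j j'; case: i => [|[|[|i]]] //; case: j => [|[|[|j]]] //; case: j' => [|[|[|j']]].
Qed.

Lemma seven_col_lt i j w : 2 < w -> (seven_col i j < w) = (j < w).
Proof. by case: i => [|[|[|i]]] //; case: j => [|[|[|j]]] //=; lia. Qed.

Lemma seven_rho_row w i j : 5 < w -> i < 3 ->
  seven_rows w (seven_rho j i) j = seven_rows w i (seven_col i j).
Proof.
move=> w5; case: i => [|[|[|]]] // _; case: j => [|[|[|j]]] //=.
all: repeat case: eqP => ?; lia.
Qed.

Lemma latin_defect_seven w : 5 < w -> sudoku_defect 1 w 7.
Proof.
move=> w5.
pose R (i j : 'I_w) := Ordinal (seven_rows_lt i w5 (ltn_ord j)).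
have R_rect : latin_rectangle 3 R.
  split=> [i i3 j j' /(congr1 val)|j i i' i3 i3' /(congr1 val)] /= e; apply: val_inj.
    exact: seven_rows_inj e.
  exact: seven_cols_inj e.
have [|L [Lr Lc] LR] := latin_rectangle_complete _ R_rect; first lia.
have latL : is_latin L by split=> [i|j i i']; [apply: Lr | apply: Lc].
have stepP (j i : 'I_w) : seven_rho j i < w.
  have [i3|i3] := ltnP i 3; last by rewrite seven_rho_ge3.
  by rewrite -(seven_rho_lt3 j) in i3; lia.
pose rho (j i : 'I_w) := Ordinal (stepP j i).
have rhoI j : injective (rho j).
  by move=> i i' /(congr1 val) /seven_rho_inj /val_inj.
have rowI i : injective (fun j => L (rho j i) j).
  move=> j j'; have [i3|i3] := ltnP i 3; last first.
    have fixed j0 : rho j0 i = i by apply: val_inj; apply: seven_rho_ge3.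
    by rewrite !fixed => /Lr->.
  rewrite !LR ?seven_rho_lt3 // => /(congr1 val) /=.
  rewrite !seven_rho_row // => /seven_rows_inj e; apply: val_inj.
  by apply: (@seven_col_inj i); apply: e; rewrite ?seven_col_lt //; lia.
have := latin_move_rows latL rhoI rowI; rewrite card_ord; congr sudoku_defect.
rewrite exchange_big -[RHS](count_seven_rho (w - 3)) subnKC //; lia.
Qed.

(** * Explicit squares *)

(** A decidable form of the Sudoku property for numbered cells.  Each line of cells is
    enumerated by a number [z < h * w]; in a box, [z] runs through the rows of the
    box, each of length [w]. *)
Definition sudoku_cells (h w : nat) (c : nat -> nat -> nat) : bool :=
  [&& all (fun i => uniq (mkseq (c i) (h * w))) (iota 0 (h * w)),
      all (fun j => uniq (mkseq (c^~ j) (h * w))) (iota 0 (h * w)),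
      all (fun a => all (fun b =>
        uniq (mkseq (fun z => c (a * h + z %/ w) (b * w + z %% w)) (h * w))) (iota 0 h)) (iota 0 w)
    & all (fun i => all (fun j => c i j < h * w) (iota 0 (h * w))) (iota 0 (h * w))].

Definition cells_defect (n : nat) (c c' : nat -> nat -> nat) : nat :=
  sumn (mkseq (fun i => sumn (mkseq (fun j => nat_of_bool (c i j != c' i j)) n)) n).

Lemma sumn_mkseq (n : nat) (F : nat -> nat) : sumn (mkseq F n) = \sum_(i < n) F i.
Proof. by rewrite sumnE big_map -{1}[n]subn0 -/(index_iota 0 n) big_mkord. Qed.

Lemma all_iota0 (n : nat) (P : pred nat) : reflect (forall i : 'I_n, P i) (all P (iota 0 n)).
Proof.
apply: (iffP allP) => [p i|p i]; first by rewrite p // mem_iota ltn_ord.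
by rewrite mem_iota => /andP[_ ltin]; apply: (p (Ordinal ltin)).
Qed.

Lemma mkseq_uniq_ord (n : nat) (F : nat -> nat) :
  reflect (injective (fun i : 'I_n => F i)) (uniq (mkseq F n)).
Proof.
apply: (iffP (mkseq_uniqP _ _)) => [FI i j /FI e|FI i j ltin ltjn].
  by apply: val_inj; apply: e; apply: ltn_ord.
by move=> e; have /(congr1 val) := FI (Ordinal ltin) (Ordinal ltjn) e.
Qed.

Section Cells.
Variables h w : nat.
Local Notation n := (h * w).

Lemma sudoku_cellsP (c : nat -> nat -> nat) :
  reflect (exists2 f : 'I_w * 'I_h -> 'I_h * 'I_w -> 'I_n, is_sudoku f
             & forall x y, c (row_of x) (col_of y) = f x y)
          (sudoku_cells h w c).
Proof.
have box_index a b (z : 'I_h * 'I_w) :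
    c (a * h + col_of z %/ w) (b * w + col_of z %% w) = c (a * h + z.1) (b * w + z.2).
  have w_gt0 : 0 < w by apply: leq_ltn_trans (ltn_ord z.2).
  by rewrite /= divnMDl // divn_small ?modnMDl ?modn_small ?addn0.
have row_bij := row_of_bij h w; have col_bij := col_of_bij h w.
have boxP (a b : nat) : uniq (mkseq (fun z => c (a * h + z %/ w) (b * w + z %% w)) n) <->
    injective (fun z : 'I_h * 'I_w => c (a * h + z.1) (b * w + z.2)).
  have [cK Kc ccK] := col_bij.
  split=> [/mkseq_uniq_ord cI z z' e|cI].
    by apply: (bij_inj col_bij); apply: cI; rewrite !box_index.
  apply/mkseq_uniq_ord => i i'; rewrite -[i]ccK -[i']ccK.
  by rewrite (box_index a b (cK i)) (box_index a b (cK i')) => /cI ->.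
apply: (iffP and4P).
  case=> /all_iota0 cr /all_iota0 cc /all_iota0 cb /all_iota0 lt.
  have ltP (i j : 'I_n) : c i j < n by move: (lt i) => /all_iota0.
  exists (fun x y => Ordinal (ltP (row_of x) (col_of y))) => //; split.
  - move=> x y y' /(congr1 val) e; have /mkseq_uniq_ord cI := cr (row_of x).
    by apply: (bij_inj col_bij); apply: cI.
  - move=> y x x' /(congr1 val) e; have /mkseq_uniq_ord cI := cc (col_of y).
    by apply: (bij_inj row_bij); apply: cI.
  - move=> a b z z' /(congr1 val) /= e.
    by have /all_iota0/(_ b)/boxP := cb a; apply.
case=> f [f1 f2 f3] cE.
have [rK Kr rrK] := row_bij; have [cK Kc ccK] := col_bij.
split; apply/all_iota0 => i.
- apply/mkseq_uniq_ord => j j'; rewrite -[i]rrK -[j]ccK -[j']ccK !cE.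
  by move/val_inj/f1->.
- apply/mkseq_uniq_ord => j j'; rewrite -[i]ccK -[j]rrK -[j']rrK !cE.
  by move/val_inj/f2->.
- apply/all_iota0 => b; apply/boxP => z z' e; apply: (f3 i b); apply: val_inj.
  by rewrite /= -!cE.
- by apply/all_iota0 => j; rewrite -[i]rrK -[j]ccK cE.
Qed.

Lemma cells_defectE (f g : 'I_w * 'I_h -> 'I_h * 'I_w -> 'I_n) (c c' : nat -> nat -> nat) :
  (forall x y, c (row_of x) (col_of y) = f x y) ->
  (forall x y, c' (row_of x) (col_of y) = g x y) ->
  cells_defect n c c' = defect f g.
Proof.
move=> cE cE'; rewrite /cells_defect sumn_mkseq.
under eq_bigr => i _ do rewrite sumn_mkseq.
rewrite -sum_row_col; apply: eq_bigr => x _; apply: eq_bigr => y _.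
by rewrite cE cE'.
Qed.

Definition cell (T : seq (seq nat)) (i j : nat) : nat := nth 0 (nth [::] T i) j.

(** A family of [m] squares yields about [m ^ 2 / 2] disagreement numbers, which keeps
    the lists of explicit squares short. *)
Definition family_defects (fam : seq (seq (seq nat))) : seq nat :=
  [seq cells_defect n (cell T) (cell T') | T <- fam, T' <- fam].

Lemma family_sudoku_defect fam d : all (fun T => sudoku_cells h w (cell T)) fam ->
  d \in family_defects fam -> sudoku_defect h w d.
Proof.
move=> /allP sud /allpairsP[[T T'] /= [/sud/sudoku_cellsP[f sf fE] ]].
move=> /sud/sudoku_cellsP[g sg gE] ->.
by exists f, g; rewrite (cells_defectE fE gE).
Qed.
End Cells.

(** These families were found by computer search.  Two suitable members of
    [squares_2_2], [squares_2_3] or [squares_3_3] disagree in any prescribed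
    possible number of cells; [squares_1_5] contains pairs that disagree in 7 and
    in 9 cells, and [squares_2_4] in 6 and in 9. *)
Definition squares_1_5 : seq (seq (seq nat)) := [::
  [:: [:: 0; 1; 2; 3; 4]; [:: 2; 3; 4; 0; 1]; [:: 3; 4; 1; 2; 0];
      [:: 4; 0; 3; 1; 2]; [:: 1; 2; 0; 4; 3]];
  [:: [:: 0; 2; 1; 3; 4]; [:: 2; 3; 4; 0; 1]; [:: 3; 1; 2; 4; 0];
      [:: 4; 0; 3; 1; 2]; [:: 1; 4; 0; 2; 3]];
  [:: [:: 1; 2; 0; 3; 4]; [:: 2; 3; 4; 0; 1]; [:: 0; 4; 1; 2; 3];
      [:: 4; 0; 3; 1; 2]; [:: 3; 1; 2; 4; 0]]].

Definition squares_2_2 : seq (seq (seq nat)) := [::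
  [:: [:: 0; 1; 2; 3]; [:: 3; 2; 0; 1]; [:: 1; 0; 3; 2]; [:: 2; 3; 1; 0]];
  [:: [:: 1; 0; 2; 3]; [:: 2; 3; 0; 1]; [:: 0; 1; 3; 2]; [:: 3; 2; 1; 0]];
  [:: [:: 0; 3; 2; 1]; [:: 1; 2; 3; 0]; [:: 3; 0; 1; 2]; [:: 2; 1; 0; 3]];
  [:: [:: 0; 2; 3; 1]; [:: 3; 1; 0; 2]; [:: 1; 0; 2; 3]; [:: 2; 3; 1; 0]];
  [:: [:: 1; 3; 0; 2]; [:: 2; 0; 3; 1]; [:: 3; 2; 1; 0]; [:: 0; 1; 2; 3]];
  [:: [:: 1; 3; 0; 2]; [:: 2; 0; 3; 1]; [:: 0; 2; 1; 3]; [:: 3; 1; 2; 0]]].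

Definition squares_2_3 : seq (seq (seq nat)) := [::
  [:: [:: 0; 1; 2; 3; 4; 5]; [:: 5; 3; 4; 2; 0; 1]; [:: 3; 4; 0; 1; 5; 2];
      [:: 1; 2; 5; 4; 3; 0]; [:: 4; 0; 1; 5; 2; 3]; [:: 2; 5; 3; 0; 1; 4]];
  [:: [:: 1; 0; 2; 3; 4; 5]; [:: 5; 3; 4; 2; 1; 0]; [:: 3; 4; 1; 0; 5; 2];
      [:: 0; 2; 5; 4; 3; 1]; [:: 4; 1; 0; 5; 2; 3]; [:: 2; 5; 3; 1; 0; 4]];
  [:: [:: 2; 3; 0; 4; 1; 5]; [:: 4; 1; 5; 3; 0; 2]; [:: 3; 2; 1; 5; 4; 0];
      [:: 0; 5; 4; 1; 2; 3]; [:: 5; 4; 2; 0; 3; 1]; [:: 1; 0; 3; 2; 5; 4]];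
  [:: [:: 2; 3; 0; 4; 1; 5]; [:: 5; 1; 4; 2; 0; 3]; [:: 3; 2; 1; 0; 5; 4];
      [:: 0; 4; 5; 3; 2; 1]; [:: 1; 0; 3; 5; 4; 2]; [:: 4; 5; 2; 1; 3; 0]];
  [:: [:: 5; 3; 2; 4; 0; 1]; [:: 0; 1; 4; 3; 2; 5]; [:: 3; 2; 0; 1; 5; 4];
      [:: 1; 4; 5; 2; 3; 0]; [:: 2; 0; 1; 5; 4; 3]; [:: 4; 5; 3; 0; 1; 2]];
  [:: [:: 0; 4; 3; 1; 5; 2]; [:: 2; 5; 1; 4; 0; 3]; [:: 4; 3; 2; 0; 1; 5];
      [:: 5; 1; 0; 3; 2; 4]; [:: 3; 0; 5; 2; 4; 1]; [:: 1; 2; 4; 5; 3; 0]];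
  [:: [:: 5; 3; 2; 4; 1; 0]; [:: 1; 0; 4; 5; 2; 3]; [:: 3; 2; 1; 0; 5; 4];
      [:: 0; 4; 5; 2; 3; 1]; [:: 2; 1; 0; 3; 4; 5]; [:: 4; 5; 3; 1; 0; 2]];
  [:: [:: 1; 0; 2; 3; 4; 5]; [:: 5; 3; 4; 2; 1; 0]; [:: 3; 4; 1; 0; 5; 2];
      [:: 0; 2; 5; 4; 3; 1]; [:: 4; 5; 0; 1; 2; 3]; [:: 2; 1; 3; 5; 0; 4]];
  [:: [:: 1; 0; 2; 4; 3; 5]; [:: 5; 3; 4; 2; 1; 0]; [:: 0; 4; 1; 3; 5; 2];
      [:: 3; 2; 5; 0; 4; 1]; [:: 4; 1; 0; 5; 2; 3]; [:: 2; 5; 3; 1; 0; 4]];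
  [:: [:: 1; 3; 4; 5; 2; 0]; [:: 5; 0; 2; 4; 1; 3]; [:: 3; 2; 1; 0; 5; 4];
      [:: 0; 4; 5; 2; 3; 1]; [:: 2; 1; 0; 3; 4; 5]; [:: 4; 5; 3; 1; 0; 2]];
  [:: [:: 1; 0; 3; 5; 4; 2]; [:: 2; 5; 4; 3; 1; 0]; [:: 3; 4; 1; 0; 2; 5];
      [:: 0; 2; 5; 4; 3; 1]; [:: 4; 1; 0; 2; 5; 3]; [:: 5; 3; 2; 1; 0; 4]];
  [:: [:: 2; 3; 0; 5; 1; 4]; [:: 5; 1; 4; 2; 0; 3]; [:: 3; 2; 1; 0; 4; 5];
      [:: 0; 4; 5; 3; 2; 1]; [:: 1; 0; 3; 4; 5; 2]; [:: 4; 5; 2; 1; 3; 0]];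
  [:: [:: 1; 0; 3; 4; 5; 2]; [:: 2; 5; 4; 3; 1; 0]; [:: 3; 4; 1; 0; 2; 5];
      [:: 0; 2; 5; 1; 3; 4]; [:: 5; 1; 0; 2; 4; 3]; [:: 4; 3; 2; 5; 0; 1]];
  [:: [:: 1; 3; 4; 5; 0; 2]; [:: 5; 2; 0; 4; 1; 3]; [:: 3; 1; 2; 0; 5; 4];
      [:: 0; 4; 5; 2; 3; 1]; [:: 2; 0; 1; 3; 4; 5]; [:: 4; 5; 3; 1; 2; 0]]].

Definition squares_2_4 : seq (seq (seq nat)) := [::
  [:: [:: 0; 1; 2; 3; 4; 5; 6; 7]; [:: 7; 5; 6; 4; 3; 1; 0; 2];
      [:: 2; 6; 3; 7; 0; 4; 1; 5]; [:: 4; 0; 1; 5; 7; 6; 2; 3];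
      [:: 6; 4; 5; 2; 1; 3; 7; 0]; [:: 1; 3; 7; 0; 6; 2; 5; 4];
      [:: 3; 2; 0; 1; 5; 7; 4; 6]; [:: 5; 7; 4; 6; 2; 0; 3; 1]];
  [:: [:: 1; 3; 2; 0; 4; 5; 6; 7]; [:: 7; 5; 6; 4; 3; 1; 0; 2];
      [:: 2; 6; 3; 7; 0; 4; 1; 5]; [:: 4; 0; 1; 5; 7; 6; 2; 3];
      [:: 6; 4; 5; 2; 1; 3; 7; 0]; [:: 0; 1; 7; 3; 6; 2; 5; 4];
      [:: 3; 2; 0; 1; 5; 7; 4; 6]; [:: 5; 7; 4; 6; 2; 0; 3; 1]];
  [:: [:: 0; 5; 2; 3; 4; 1; 6; 7]; [:: 7; 1; 6; 4; 3; 5; 0; 2];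
      [:: 2; 6; 3; 7; 0; 4; 1; 5]; [:: 4; 0; 1; 5; 7; 6; 2; 3];
      [:: 6; 4; 5; 2; 1; 3; 7; 0]; [:: 1; 3; 7; 0; 6; 2; 5; 4];
      [:: 3; 2; 0; 1; 5; 7; 4; 6]; [:: 5; 7; 4; 6; 2; 0; 3; 1]]].

Definition squares_3_3 : seq (seq (seq nat)) := [::
  [:: [:: 0; 1; 2; 3; 4; 5; 6; 7; 8]; [:: 3; 5; 7; 1; 8; 6; 4; 0; 2];
      [:: 6; 8; 4; 2; 0; 7; 1; 5; 3]; [:: 2; 7; 3; 6; 5; 0; 8; 4; 1];
      [:: 5; 0; 8; 4; 1; 3; 7; 2; 6]; [:: 4; 6; 1; 8; 7; 2; 5; 3; 0];
      [:: 1; 3; 0; 5; 6; 4; 2; 8; 7]; [:: 8; 2; 5; 7; 3; 1; 0; 6; 4];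
      [:: 7; 4; 6; 0; 2; 8; 3; 1; 5]];
  [:: [:: 0; 2; 1; 3; 4; 5; 6; 7; 8]; [:: 3; 5; 7; 2; 8; 6; 4; 0; 1];
      [:: 6; 8; 4; 1; 0; 7; 2; 5; 3]; [:: 1; 7; 3; 6; 5; 0; 8; 4; 2];
      [:: 5; 0; 8; 4; 2; 3; 7; 1; 6]; [:: 4; 6; 2; 8; 7; 1; 5; 3; 0];
      [:: 2; 3; 0; 5; 6; 4; 1; 8; 7]; [:: 8; 1; 5; 7; 3; 2; 0; 6; 4];
      [:: 7; 4; 6; 0; 1; 8; 3; 2; 5]];
  [:: [:: 0; 2; 1; 4; 3; 5; 6; 7; 8]; [:: 3; 5; 7; 8; 2; 6; 4; 0; 1];
      [:: 6; 8; 4; 1; 0; 7; 2; 5; 3]; [:: 1; 7; 3; 5; 6; 0; 8; 4; 2];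
      [:: 5; 0; 8; 3; 4; 2; 7; 1; 6]; [:: 4; 6; 2; 7; 1; 8; 5; 3; 0];
      [:: 8; 1; 5; 2; 7; 3; 0; 6; 4]; [:: 2; 3; 0; 6; 5; 4; 1; 8; 7];
      [:: 7; 4; 6; 0; 8; 1; 3; 2; 5]];
  [:: [:: 0; 2; 1; 4; 3; 5; 6; 7; 8]; [:: 3; 5; 7; 8; 2; 6; 4; 0; 1];
      [:: 6; 8; 4; 1; 0; 7; 2; 5; 3]; [:: 1; 7; 3; 5; 4; 0; 8; 6; 2];
      [:: 5; 0; 8; 3; 6; 2; 7; 1; 4]; [:: 4; 6; 2; 7; 1; 8; 5; 3; 0];
      [:: 8; 1; 5; 2; 7; 3; 0; 4; 6]; [:: 2; 3; 0; 6; 5; 4; 1; 8; 7];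
      [:: 7; 4; 6; 0; 8; 1; 3; 2; 5]];
  [:: [:: 6; 3; 4; 0; 8; 5; 1; 7; 2]; [:: 0; 5; 2; 1; 4; 7; 6; 8; 3];
      [:: 8; 1; 7; 2; 3; 6; 4; 5; 0]; [:: 2; 7; 8; 6; 5; 0; 3; 4; 1];
      [:: 5; 0; 3; 4; 1; 8; 7; 2; 6]; [:: 4; 6; 1; 3; 7; 2; 5; 0; 8];
      [:: 1; 8; 0; 5; 6; 4; 2; 3; 7]; [:: 3; 2; 5; 7; 0; 1; 8; 6; 4];
      [:: 7; 4; 6; 8; 2; 3; 0; 1; 5]];
  [:: [:: 3; 2; 1; 4; 0; 5; 6; 7; 8]; [:: 0; 5; 7; 8; 2; 6; 4; 3; 1];
      [:: 6; 8; 4; 1; 3; 7; 2; 5; 0]; [:: 1; 7; 3; 5; 6; 0; 8; 4; 2];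
      [:: 5; 0; 8; 3; 4; 2; 7; 1; 6]; [:: 4; 6; 2; 7; 1; 8; 5; 0; 3];
      [:: 8; 1; 5; 2; 7; 3; 0; 6; 4]; [:: 2; 3; 0; 6; 5; 4; 1; 8; 7];
      [:: 7; 4; 6; 0; 8; 1; 3; 2; 5]];
  [:: [:: 2; 0; 1; 4; 3; 5; 6; 7; 8]; [:: 5; 7; 3; 8; 2; 6; 4; 0; 1];
      [:: 4; 6; 8; 1; 0; 7; 2; 5; 3]; [:: 3; 1; 7; 5; 4; 0; 8; 6; 2];
      [:: 8; 5; 0; 3; 6; 2; 7; 1; 4]; [:: 6; 2; 4; 7; 1; 8; 5; 3; 0];
      [:: 1; 8; 5; 2; 7; 3; 0; 4; 6]; [:: 0; 3; 2; 6; 5; 4; 1; 8; 7];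
      [:: 7; 4; 6; 0; 8; 1; 3; 2; 5]];
  [:: [:: 0; 2; 1; 3; 4; 5; 6; 7; 8]; [:: 3; 5; 7; 2; 8; 6; 4; 0; 1];
      [:: 6; 8; 4; 1; 0; 7; 2; 5; 3]; [:: 1; 7; 3; 6; 5; 0; 8; 4; 2];
      [:: 4; 0; 2; 8; 7; 3; 5; 1; 6]; [:: 5; 6; 8; 4; 2; 1; 7; 3; 0];
      [:: 2; 3; 0; 5; 6; 4; 1; 8; 7]; [:: 8; 1; 5; 7; 3; 2; 0; 6; 4];
      [:: 7; 4; 6; 0; 1; 8; 3; 2; 5]];
  [:: [:: 6; 2; 1; 3; 4; 5; 7; 0; 8]; [:: 3; 5; 0; 2; 8; 7; 1; 4; 6];
      [:: 7; 8; 4; 1; 6; 0; 3; 5; 2]; [:: 4; 0; 8; 7; 2; 1; 6; 3; 5];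
      [:: 1; 6; 2; 8; 5; 3; 0; 7; 4]; [:: 5; 7; 3; 4; 0; 6; 2; 8; 1];
      [:: 2; 3; 6; 5; 7; 4; 8; 1; 0]; [:: 8; 1; 5; 0; 3; 2; 4; 6; 7];
      [:: 0; 4; 7; 6; 1; 8; 5; 2; 3]];
  [:: [:: 7; 1; 3; 6; 2; 0; 5; 8; 4]; [:: 2; 6; 4; 3; 8; 5; 1; 0; 7];
      [:: 5; 0; 8; 7; 4; 1; 3; 2; 6]; [:: 8; 4; 0; 2; 1; 6; 7; 3; 5];
      [:: 6; 2; 7; 0; 5; 3; 8; 4; 1]; [:: 1; 3; 5; 8; 7; 4; 2; 6; 0];
      [:: 0; 5; 6; 1; 3; 2; 4; 7; 8]; [:: 4; 7; 2; 5; 6; 8; 0; 1; 3];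
      [:: 3; 8; 1; 4; 0; 7; 6; 5; 2]];
  [:: [:: 3; 2; 1; 4; 0; 5; 6; 7; 8]; [:: 0; 5; 7; 8; 2; 6; 4; 3; 1];
      [:: 6; 8; 4; 1; 3; 7; 2; 5; 0]; [:: 4; 6; 2; 5; 1; 8; 7; 0; 3];
      [:: 1; 7; 8; 3; 6; 0; 5; 4; 2]; [:: 5; 0; 3; 7; 4; 2; 8; 1; 6];
      [:: 8; 1; 5; 2; 7; 3; 0; 6; 4]; [:: 2; 3; 0; 6; 5; 4; 1; 8; 7];
      [:: 7; 4; 6; 0; 8; 1; 3; 2; 5]];
  [:: [:: 3; 2; 1; 4; 0; 5; 6; 7; 8]; [:: 0; 5; 7; 8; 2; 6; 4; 3; 1];
      [:: 6; 8; 4; 1; 7; 3; 2; 5; 0]; [:: 1; 3; 5; 7; 6; 0; 8; 4; 2];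
      [:: 7; 0; 8; 3; 4; 2; 5; 1; 6]; [:: 4; 6; 2; 5; 1; 8; 3; 0; 7];
      [:: 5; 1; 3; 2; 8; 7; 0; 6; 4]; [:: 2; 7; 0; 6; 5; 4; 1; 8; 3];
      [:: 8; 4; 6; 0; 3; 1; 7; 2; 5]];
  [:: [:: 0; 7; 1; 3; 4; 5; 6; 2; 8]; [:: 3; 5; 8; 2; 7; 6; 4; 0; 1];
      [:: 6; 2; 4; 1; 0; 8; 7; 5; 3]; [:: 1; 8; 3; 6; 5; 0; 2; 4; 7];
      [:: 5; 0; 7; 4; 2; 3; 8; 1; 6]; [:: 4; 6; 2; 7; 8; 1; 5; 3; 0];
      [:: 7; 3; 0; 5; 6; 4; 1; 8; 2]; [:: 2; 1; 5; 8; 3; 7; 0; 6; 4];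
      [:: 8; 4; 6; 0; 1; 2; 3; 7; 5]];
  [:: [:: 3; 2; 1; 4; 0; 5; 6; 7; 8]; [:: 0; 5; 7; 8; 2; 6; 4; 3; 1];
      [:: 6; 8; 4; 1; 3; 7; 2; 5; 0]; [:: 1; 7; 2; 5; 6; 0; 8; 4; 3];
      [:: 5; 0; 8; 3; 4; 2; 7; 1; 6]; [:: 4; 6; 3; 7; 1; 8; 5; 0; 2];
      [:: 8; 1; 5; 2; 7; 3; 0; 6; 4]; [:: 2; 3; 0; 6; 5; 4; 1; 8; 7];
      [:: 7; 4; 6; 0; 8; 1; 3; 2; 5]];
  [:: [:: 3; 2; 1; 4; 0; 5; 6; 7; 8]; [:: 0; 5; 7; 8; 2; 6; 4; 3; 1];
      [:: 6; 8; 4; 3; 1; 7; 2; 5; 0]; [:: 1; 7; 3; 5; 6; 0; 8; 4; 2];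
      [:: 5; 0; 8; 2; 4; 3; 7; 1; 6]; [:: 4; 6; 2; 1; 7; 8; 5; 0; 3];
      [:: 8; 1; 5; 7; 3; 2; 0; 6; 4]; [:: 2; 3; 0; 6; 5; 4; 1; 8; 7];
      [:: 7; 4; 6; 0; 8; 1; 3; 2; 5]];
  [:: [:: 3; 2; 1; 4; 0; 5; 6; 7; 8]; [:: 0; 5; 7; 8; 2; 6; 4; 3; 1];
      [:: 4; 8; 6; 1; 3; 7; 5; 2; 0]; [:: 1; 7; 2; 5; 6; 0; 8; 4; 3];
      [:: 5; 0; 8; 3; 4; 2; 7; 1; 6]; [:: 6; 4; 3; 7; 1; 8; 2; 0; 5];
      [:: 8; 1; 5; 2; 7; 3; 0; 6; 4]; [:: 2; 3; 0; 6; 5; 4; 1; 8; 7];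
      [:: 7; 6; 4; 0; 8; 1; 3; 5; 2]];
  [:: [:: 0; 2; 1; 4; 3; 5; 6; 7; 8]; [:: 3; 5; 7; 8; 2; 6; 4; 0; 1];
      [:: 6; 8; 4; 1; 0; 7; 2; 5; 3]; [:: 1; 7; 5; 3; 4; 0; 8; 6; 2];
      [:: 8; 0; 3; 5; 6; 2; 7; 1; 4]; [:: 4; 6; 2; 7; 1; 8; 5; 3; 0];
      [:: 5; 1; 8; 2; 7; 3; 0; 4; 6]; [:: 2; 3; 0; 6; 5; 4; 1; 8; 7];
      [:: 7; 4; 6; 0; 8; 1; 3; 2; 5]]].

(** Under call by value, [mem t] evaluates [t] once, not once per element of [s]. *)
Lemma all_mem_subset (s t : seq nat) : all (mem t) s -> {subset s <= t}.
Proof. by move/allP=> st x /st. Qed.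

Lemma latin_defect_order_five d : d \in [:: 7; 9] -> sudoku_defect 1 5 d.
Proof.
move=> d79; apply: (@family_sudoku_defect 1 5 squares_1_5); first by vm_compute.
by move: d79; rewrite !inE => /orP[] /eqP->; vm_compute.
Qed.

(** Nine disagreements come from rotating a latin subsquare of order 3, which leaves
    room for [w - 3 >= 3] further columns only if [w >= 6]. *)
Lemma latin_defect_seven_nine w d : 4 < w -> d \in [:: 7; 9] -> sudoku_defect 1 w d.
Proof.
rewrite leq_eqVlt => /predU1P[<-|w5]; first exact: latin_defect_order_five.
rewrite !inE => /orP[] /eqP->; first exact: latin_defect_seven.
by have := @latin_defect_rows w 3 3 0; rewrite muln0; apply; lia.
Qed.

Definition defects_2_2 : seq nat := [:: 0; 4; 7; 8; 10; 12; 13; 14; 15; 16].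

Lemma sudoku_defect_2_2_sufficient d : d \in defects_2_2 -> sudoku_defect 2 2 d.
Proof.
move=> dP; apply: (@family_sudoku_defect 2 2 squares_2_2); first by vm_compute.
by move: d dP; apply: all_mem_subset; vm_compute.
Qed.

(** Sudoku squares of type [(2, 2)] are in particular latin squares of order 4. *)
Lemma latin_defect_four d : d \in defects_2_2 -> sudoku_defect 1 4 d.
Proof.
move=> dP; apply: (@family_sudoku_defect 1 4 squares_2_2); first by vm_compute.
move: d dP; by apply: all_mem_subset; vm_compute.
Qed.

(** * Sums of defects *)

Lemma sums1 (P : nat -> Prop) d : P d -> sums P 1 d.
Proof. by exists [:: d]; split=> [|x /[!inE]/eqP->|] //=; rewrite addn0. Qed.

Lemma sumsD (P : nat -> Prop) k k' d d' :
  sums P k d -> sums P k' d' -> sums P (k + k') (d + d').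
Proof.
case=> s [<- sP <-] [s' [<- sP' <-]]; exists (s ++ s').
split=> [|x|]; rewrite ?size_cat ?sumn_cat // mem_cat => /orP[]; [exact: sP | exact: sP'].
Qed.

Lemma sums_nil (P : nat -> Prop) : sums P 0 0.
Proof. by exists [::]. Qed.

Fixpoint sumset (s : seq nat) (k : nat) : seq nat :=
  if k is k'.+1 then undup [seq x + y | x <- s, y <- sumset s k'] else [:: 0].

Lemma sumsetP (P : nat -> Prop) (s : seq nat) (k d : nat) :
  (forall x, x \in s -> P x) -> d \in sumset s k -> sums P k d.
Proof.
move=> sP; elim: k d => [|k IH] d /=; first by rewrite inE => /eqP->; apply: sums_nil.
by rewrite mem_undup => /allpairsP[[x y] [/sP/sums1 Px /IH Py ->]]; apply: (sumsD Px).
Qed.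

Lemma sums_pad (P : nat -> Prop) j k d : P 0 -> j <= k -> sums P j d -> sums P k d.
Proof.
move=> P0 jk Pd; rewrite -(subnKC jk) -[d]addn0; apply: (sumsD Pd).
elim: (k - j) => [|i IH]; first exact: sums_nil.
exact: (sumsD (sums1 P0) IH).
Qed.

(** One more summand shifts the attainable range by [0] or [N].  The range starts at 10
    because in the application with [N = 16] the numbers 6 and 9 are not sums. *)
Lemma sums_grow (P : nat -> Prop) (N j d : nat) : P 0 -> P N -> 9 <= 3 * N ->
  (forall e, 9 < e <= 4 * N -> sums P 4 e) -> 4 <= j -> 9 < d <= j * N -> sums P j d.
Proof.
move=> P0 PN N3 base; elim: j d => // j IH d; rewrite leq_eqVlt => /predU1P[<-|ltj].
  exact: base.
have [dj|dj] := leqP d (j * N) => d9.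
  by apply: (sums_pad P0 (leqnSn j)); apply: IH => //; lia.
rewrite -addn1 -(@subnK N d); last nia.
apply: sumsD (sums1 PN); apply: IH => //; nia.
Qed.

(** * Width at least five *)

Section LargeOrder.
Variable w : nat.
Hypothesis w5 : 4 < w.
Local Notation P := (sudoku_defect 1 w).

Definition swap_size (t : nat) : bool := [|| t == 0, t == w | 2 <= t <= w - 2].
Definition rotation_size (k : nat) : bool := (k != 1) && (k <= w - 2).

Lemma latin_defect_even t k : swap_size t -> rotation_size k -> P (2 * t + w * k).
Proof.
move=> tP /andP[k1 kw]; apply: latin_defect_rows => //; move: tP; rewrite /swap_size; lia.
Qed.

Lemma latin_defect_none : P 0.
Proof. by have := @latin_defect_even 0 0; rewrite /swap_size !muln0; apply. Qed.

Lemma latin_defect_full : P (w ^ 2).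
Proof.
have -> : w ^ 2 = 2 * w + w * (w - 2) by rewrite -[w ^ 2]/(w * w); nia.
by apply: latin_defect_even; rewrite /swap_size /rotation_size; lia.
Qed.

(** [T] splits as [t + t'] with two swap sizes, and [2 * kappa] as [k + k'] with two
    rotation sizes; the excluded [T] are those that would need a swap on 1 or
    [w - 1] columns. *)
Lemma sums_even T kappa : T <= 2 * w -> T != 1 -> T != 2 * w - 1 -> kappa <= w - 2 ->
  sums P 2 (2 * (T + w * kappa)).
Proof.
move=> T2w T1 T2w1 kw.
have [t [t' [tP t'P ->]]] : exists t t', [/\ swap_size t, swap_size t' & T = t + t'].
  rewrite /swap_size; have [?|?] := leqP T (w - 2); first by exists T, 0; split; lia.
  have [?|?] := leqP (w + 2) T; first by exists w, (T - w); split; lia.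
  have [?|?] := eqVneq T (w - 1); first by exists 2, (w - 3); split; lia.
  have [?|?] := eqVneq T w; first by exists w, 0; split; lia.
  by exists 3, (w - 2); split; lia.
have [k [k' [kP k'P eK]]] :
    exists k k', [/\ rotation_size k, rotation_size k' & 2 * kappa = k + k'].
  rewrite /rotation_size; have [->|?] := eqVneq kappa 1; first by exists 2, 0; split; lia.
  by exists kappa, kappa; split; lia.
rewrite (_ : 2 * _ = (2 * t + w * k) + (2 * t' + w * k')); last by nia.
by apply: (@sumsD _ 1 1); apply: sums1; apply: latin_defect_even.
Qed.

Lemma sums_all_even e : ~~ odd e -> e <= 2 * w ^ 2 -> e != 2 -> e != 2 * w ^ 2 - 2 ->
  sums P 2 e.
Proof.
move=> e_even le_e e2 e2w.
have [f fE] : exists f, e = 2 * f by exists e./2; lia.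
have w_gt0 : 0 < w by lia.
have := divn_eq f w; have := ltn_pmod f w_gt0.
move: (f %/ w) (f %% w) => q r rw fqr.
rewrite -[w ^ 2]/(w * w) in le_e e2w.
(* Write the half f as q * w + r and move w or 2 * w into T where needed. *)
suff [T [kappa [? ? ? ? eT]]] : exists T kappa,
   [/\ T <= 2 * w, T != 1, T != 2 * w - 1, kappa <= w - 2 & f = T + w * kappa].
  by rewrite fE eT; apply: sums_even.
have f_le : f <= w * w by lia.
have f1 : f != 1 by lia.
have fw1 : f != w * w - 1 by lia.
case: q fqr => [|q] fqr; first by exists r, 0; split; lia.
have q_lt : q < w by nia.
have [r1|r1] := eqVneq r 1.
  have ? : q != w - 1 by apply/eqP; nia.
  by exists (w + 1), q; split; nia.
have [q2|q2] := leqP q.+1 (w - 2); first by exists r, q.+1; split; nia.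
have [qE|qE] : q = w - 2 \/ q = w - 1 by lia.
  have ? : r != w - 1 by apply/eqP; nia.
  by exists (w + r), (w - 2); split; nia.
have r0 : r = 0 by nia.
by exists (w + w), (w - 2); split; nia.
Qed.

(** Let [N = w ^ 2].  By [sums_all_even] two squares give all even numbers up to [2 * N]
    except 2 and [2 * N - 2].  An even number is a sum of two of these; an odd
    one takes [7 + 0] from the other two squares if it is small and
    [(N - 1) + N] if it is large.  The few numbers that would need an excluded
    summand are decomposed by hand. *)
Lemma sums_four d : d <= 4 * w ^ 2 -> admissible d -> sums P 4 d.
Proof.
have ev := sums_all_even.
have N25 : 25 <= w ^ 2 by rewrite -[w ^ 2]/(w * w); nia.
have [P0 PN] := (latin_defect_none, latin_defect_full).
have P7 : P 7 by apply: latin_defect_seven_nine.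
have P9 : P 9 by apply: latin_defect_seven_nine.
have PN1 : P (w ^ 2 - 1) by rewrite subn1; apply: latin_defect_all_but_one.
move: (w ^ 2) N25 ev PN PN1 => N N25 ev PN PN1 dN; rewrite /admissible !inE => d1235.
have two a b : P a -> P b -> sums P 2 (a + b) by move=> Pa Pb; apply: (@sumsD _ 1 1); apply: sums1.
have split2 a b : sums P 2 a -> sums P 2 b -> d = a + b -> sums P 4 d.
  by move=> Pa Pb ->; apply: (@sumsD _ 2 2).
case: (boolP (odd d)) => d_odd.
  have [d9|d9] := eqVneq d 9; first by apply: (split2 (9 + 0) (0 + 0)); [exact: two..| lia].
  have [d2N|d2N] := leqP d (2 * N + 1).
    by apply: (split2 (7 + 0) (d - 7)); [exact: two | apply: ev; lia | lia].
  have [d4N|d4N] := eqVneq d (4 * N - 3).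
    by apply: (split2 ((N - 1) + (N - 1)) ((N - 1) + N)); [exact: two..| lia].
  by apply: (split2 ((N - 1) + N) (d - (2 * N - 1))); [exact: two | apply: ev; lia | lia].
have [d4N|d4N] := eqVneq d (4 * N - 2).
  by apply: (split2 ((N - 1) + (N - 1)) (N + N)); [exact: two..| lia].
have [d2N|d2N] := eqVneq d (2 * N - 2).
  by apply: (split2 4 (2 * N - 6)); [apply: ev; lia.. | lia].
have [d2N'|d2N'] := eqVneq d (2 * N + 2).
  by apply: (split2 6 (2 * N - 4)); [apply: ev; lia.. | lia].
have [led|led] := leqP d (2 * N).
  by apply: (split2 d 0); [apply: ev; lia.. | lia].
by apply: (split2 (2 * N) (d - 2 * N)); [apply: ev; lia.. | lia].
Qed.
End LargeOrder.

Lemma sudoku_defect_large h w d : 1 < h -> 4 < w -> d <= (h * w) ^ 2 -> admissible d ->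
  sudoku_defect h w d.
Proof.
move=> h1 w4; rewrite expnMn => d_le d_adm; rewrite -[h]muln1.
apply: sudoku_defect_inflate; first lia.
have four := sums_four w4.
have N25 : 25 <= w ^ 2 by rewrite -[w ^ 2]/(w * w); nia.
have P0 := latin_defect_none w4.
have h4 : 4 <= h ^ 2 by rewrite -[h ^ 2]/(h * h); nia.
have [d9|d9] := leqP d 9; first by apply: (sums_pad P0 h4); apply: four => //; lia.
apply: (@sums_grow _ (w ^ 2)) => //.
- exact: latin_defect_full.
- lia.
- by move=> e e9; apply: four; [lia | rewrite /admissible !inE; lia].
- by rewrite d9.
Qed.

(** * Width at most four *)

(** Four or more elements of [defects_2_2] add up to every admissible number except 6
    and 9, which have to come from elsewhere. *)
Lemma sudoku_defect_width_four h d : 1 < h -> sudoku_defect h 4 6 -> sudoku_defect h 4 9 ->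
  d <= (h * 4) ^ 2 -> admissible d -> sudoku_defect h 4 d.
Proof.
move=> h1 P6 P9; rewrite expnMn /admissible !inE => d_le d_adm.
have [->//|d6] := eqVneq d 6; have [->//|d9] := eqVneq d 9.
rewrite -[h]muln1; apply: sudoku_defect_inflate; first lia.
have P0 := @latin_defect_four 0 isT.
have h4 : 4 <= h ^ 2 by rewrite -[h ^ 2]/(h * h); nia.
have [d_small|d_large] := leqP d 9.
  apply: (@sums_pad _ 1) => //; first lia.
  by apply/sums1/latin_defect_four; rewrite !inE; lia.
apply: (@sums_grow _ 16) => //; first exact: latin_defect_four; last by rewrite d_large.
move=> e e_range; apply: (sumsetP latin_defect_four).
have sub : {subset iota 10 55 <= sumset defects_2_2 4}.
  by apply: all_mem_subset; vm_compute.
by apply: sub; rewrite mem_iota; lia.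
Qed.

Lemma sudoku_defect_2_4 d : d <= 8 ^ 2 -> admissible d -> sudoku_defect 2 4 d.
Proof.
have fam e : e \in [:: 6; 9] -> sudoku_defect 2 4 e.
  move=> eP; apply: (@family_sudoku_defect 2 4 squares_2_4); first by vm_compute.
  by move: eP; rewrite !inE => /orP[] /eqP->; vm_compute.
by apply: (@sudoku_defect_width_four 2) => //; apply: fam.
Qed.

(** Rotating two or three rows of a latin square of order 3 gives 6 and 9.  Type
    [(1, 3)] inflates to [(4, 3)], the transpose of [(3, 4)]. *)
Lemma sudoku_defect_3_4 d : d <= 12 ^ 2 -> admissible d -> sudoku_defect 3 4 d.
Proof.
have trow k : k \in [:: 2; 3] -> sudoku_defect 3 4 (3 * k).
  move=> kP; apply: sudoku_defect_transpose; rewrite -[4]muln1.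
  apply: sudoku_defect_inflate => //; apply: (@sums_pad _ 1) => //.
    by apply: (@latin_defect_rows 3 2 0 0).
  apply: sums1; move: kP; rewrite !inE => /orP[] /eqP->.
    by apply: (@latin_defect_rows 3 2 3 0).
  by apply: (@latin_defect_rows 3 3 3 0).
by apply: (@sudoku_defect_width_four 3); [|apply: (trow 2)|apply: (trow 3)].
Qed.

(** A square of type [(4, 4)] contains four independent squares of type [(2, 4)]. *)
Lemma sudoku_defect_4_4 d : d <= 16 ^ 2 -> admissible d -> sudoku_defect 4 4 d.
Proof.
have one e : e <= 64 -> admissible e -> sudoku_defect 4 4 e.
  move=> e64 e_adm; apply: (@sudoku_defect_inflate 2 4 2) => //.
  by apply: (@sums_pad _ 1) => //; [|apply: sums1]; apply: sudoku_defect_2_4.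
by apply: (@sudoku_defect_width_four 4) => //; apply: one.
Qed.

Lemma sudoku_defect_2_3 d : d <= 6 ^ 2 -> admissible d -> sudoku_defect 2 3 d.
Proof.
move=> d_le d_adm; apply: (@family_sudoku_defect 2 3 squares_2_3); first by vm_compute.
have : d \in [seq e <- iota 0 37 | admissible e] by rewrite mem_filter d_adm mem_iota.
by move: d {d_le d_adm}; apply: all_mem_subset; vm_compute.
Qed.

Lemma sudoku_defect_3_3 d : d <= 9 ^ 2 -> admissible d -> sudoku_defect 3 3 d.
Proof.
move=> d_le d_adm; apply: (@family_sudoku_defect 3 3 squares_3_3); first by vm_compute.
have : d \in [seq e <- iota 0 82 | admissible e] by rewrite mem_filter d_adm mem_iota.
by move: d {d_le d_adm}; apply: all_mem_subset; vm_compute.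
Qed.

Lemma sudoku_defect_sufficient h w d : 1 < h -> 1 < w -> (h, w) != (2, 2) ->
  d <= (h * w) ^ 2 -> admissible d -> sudoku_defect h w d.
Proof.
move=> h1 w1 hw22 d_le d_adm.
wlog hw : h w h1 w1 hw22 d_le / h <= w.
  move=> wl; have [hw|/ltnW wh] := leqP h w; first exact: wl.
  apply: sudoku_defect_transpose; apply: wl => //; last by rewrite mulnC.
  by apply: contraNneq hw22 => -[-> ->].
have [w4|w4] := ltnP 4 w; first exact: sudoku_defect_large.
case: w w1 hw22 d_le hw w4 => [|[|[|[|[|]]]]] // _.
- by case: h h1 => [|[|[|]]].
- case: h h1 => [|[|[|[|]]]] // _ _ d_le _ _; first exact: sudoku_defect_2_3.
  exact: sudoku_defect_3_3.
case: h h1 => [|[|[|[|[|]]]]] // _ _ d_le _ _.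
- exact: sudoku_defect_2_4.
- exact: sudoku_defect_3_4.
exact: sudoku_defect_4_4.
Qed.

(** * Type (2, 2) *)

Definition rows4 : seq (seq nat) := permutations (iota 0 4).

Definition bands4 : seq (seq nat * seq nat) :=
  [seq r <- [seq (r0, r1) | r0 <- rows4, r1 <- rows4] |
     uniq (take 2 r.1 ++ take 2 r.2) && uniq (drop 2 r.1 ++ drop 2 r.2)].

(** All 288 Sudoku squares of type [(2, 2)], assembled from pairs of rows that satisfy
    the box condition. *)
Definition squares4 : seq (seq (seq nat)) :=
  [seq T <- [seq [:: b.1; b.2; b'.1; b'.2] | b <- bands4, b' <- bands4] |
     all (fun j => uniq (map (nth 0 ^~ j) T)) (iota 0 4)].

Definition table4 (c : nat -> nat -> nat) : seq (seq nat) := mkseq (fun i => mkseq (c i) 4) 4.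

Lemma table4_mem (c : nat -> nat -> nat) : sudoku_cells 2 2 c -> table4 c \in squares4.
Proof.
case/and4P => /all_iota0 rU cols /all_iota0 bU /all_iota0 lt.
have rowP (i : 'I_4) : mkseq (c i) 4 \in rows4.
  rewrite mem_permutations.
  have sub : {subset mkseq (c i) 4 <= iota 0 4}.
    move=> x /mapP[j + ->]; rewrite !mem_iota => j4.
    by have /all_iota0/(_ (Ordinal j4)) := lt i.
  have [] := uniq_min_size (rU i) sub; rewrite ?size_mkseq ?size_iota // => _ eqi.
  by apply: uniq_perm => //; apply: rU.
have box (a b : 'I_2) := elimT (all_iota0 _ _) (bU a) b.
have band0 : (mkseq (c 0) 4, mkseq (c 1) 4) \in bands4.
  rewrite mem_filter; apply/andP; split.
    by apply/andP; split; [exact: (box ord0 ord0) | exact: (box ord0 ord_max)].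
  by apply: allpairs_f; [exact: (rowP (@Ordinal 4 0 isT)) | exact: (rowP (@Ordinal 4 1 isT))].
have band1 : (mkseq (c 2) 4, mkseq (c 3) 4) \in bands4.
  rewrite mem_filter; apply/andP; split.
    by apply/andP; split; [exact: (box ord_max ord0) | exact: (box ord_max ord_max)].
  by apply: allpairs_f; [exact: (rowP (@Ordinal 4 2 isT)) | exact: (rowP (@Ordinal 4 3 isT))].
rewrite mem_filter; apply/andP; split; first exact: cols.
by apply/allpairsP; exists ((mkseq (c 0) 4, mkseq (c 1) 4), (mkseq (c 2) 4, mkseq (c 3) 4)).
Qed.

(** A common relabelling of the symbols changes no disagreement, so the first of two
    squares may be assumed to have the first box [0 1 / 2 3]. *)
Definition normalized_squares4 : seq (seq (seq nat)) :=
  [seq T <- squares4 | take 2 (nth [::] T 0) ++ take 2 (nth [::] T 1) == iota 0 4].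

Lemma squares4_defects : all (fun T => all (fun T' =>
  cells_defect 4 (cell T) (cell T') \in defects_2_2) squares4) normalized_squares4.
Proof. by vm_compute. Qed.

Lemma sudoku_postcomp (A R B C S S' : finType) (s : S -> S') (f : A * R -> B * C -> S) :
  injective s -> is_sudoku f -> is_sudoku (fun x y => s (f x y)).
Proof.
move=> sI [f1 f2 f3]; split=> [x y y' /sI|y x x' /sI|a b z z' /sI].
- exact: f1.
- exact: f2.
- exact: f3.
Qed.

Lemma sudoku_defect_2_2_necessary d : sudoku_defect 2 2 d -> d \in defects_2_2.
Proof.
case=> f [g [sf sg <-]].
have [_ _ /(_ ord0 ord0) f3] := sf.
have [s sK Ks] : bijective (fun z : 'I_2 * 'I_2 => f (ord0, z.1) (ord0, z.2)).
  by apply: inj_card_bij => //; rewrite card_prod !card_ord.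
(* Relabelling by t numbers the first box of f in reading order. *)
pose t (k : 'I_(2 * 2)) := col_of (s k).
have tI : injective t.
  move=> k k' /(bij_inj (col_of_bij 2 2)).
  by move/(congr1 (fun z => f (ord0, z.1) (ord0, z.2))); rewrite !Ks.
have [rK Kr _] := row_of_bij 2 2; have [cK Kc _] := col_of_bij 2 2.
pose cells (k : _ -> _ -> 'I_(2 * 2)) i j : nat := t (k (rK (inord i)) (cK (inord j))).
have cellsE k x y : cells k (row_of x) (col_of y) = t (k x y).
  by rewrite /cells !inord_val Kr Kc.
have mem k : is_sudoku k -> table4 (cells k) \in squares4.
  move=> sk; apply/table4_mem/sudoku_cellsP; exists (fun x y => t (k x y)) => //.
  exact: sudoku_postcomp.
have -> : defect f g = cells_defect 4 (cell (table4 (cells f))) (cell (table4 (cells g))).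
  transitivity (defect (fun x y => t (f x y)) (fun x y => t (g x y))).
    by apply: eq_bigr => x _; apply: eq_bigr => y _; rewrite (inj_eq tI).
  by apply/esym/(@cells_defectE 2 2) => x y; rewrite /cell !nth_mkseq ?cellsE.
have corner (r c : 'I_2) : cells f r c = r * 2 + c.
  have -> : cells f r c = t (f (ord0, r) (ord0, c)) by rewrite -cellsE.
  by rewrite /t (sK (r, c)).
have f_norm : table4 (cells f) \in normalized_squares4.
  rewrite mem_filter (mem f sf) andbT; apply/eqP.
  by have := (corner ord0 ord0, corner ord0 ord_max, corner ord_max ord0, corner ord_max ord_max)
    => /= -[[[-> ->] ->] ->].
exact: (allP (allP squares4_defects _ f_norm) _ (mem g sg)).
Qed.

Theorem theorem1p2 (h w : nat) (hh : 2 <= h) (hw : 2 <= w) (m : nat) :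
  (m \in intersection_sizes h w) =
    (if (h == 2) && (w == 2)
     then m \in [:: 0; 1; 2; 3; 4; 6; 8; 9; 12; 16]
     else m \in Upsilon (h * w)).
Proof.
rewrite -xpair_eqE; case: ifP => [/eqP[-> ->]|/negbT hw22].
  apply/intersection_sizesP/idP => [[d /sudoku_defect_2_2_necessary]|m_in].
    by rewrite !inE; lia.
  exists (16 - m); last by move: m_in; rewrite !inE; lia.
  by apply: sudoku_defect_2_2_sufficient; move: m_in; rewrite !inE; lia.
apply/intersection_sizesP/idP => [[d /sudoku_defect_necessary[d_le]]|m_in].
  by rewrite /admissible !inE; lia.
exists ((h * w) ^ 2 - m); last by move: m_in; rewrite !inE; lia.
apply: sudoku_defect_sufficient => //; first exact: leq_subr.
by move: m_in; rewrite /admissible !inE; lia.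
Qed.
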